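(* Let $(F|K,v)$ be a valued function field (i.e. $F|K$ is a finitely generated field extension) such that $F|K$ is separable and $(F|K,v)$ is without transcendence defect, with $r=\dim_{\mathbb Q}\mathbb Q\otimes(vF/vK)$ and $s=\operatorname{trdeg}Fv|Kv$. Then there is a transcendence basis $\mathcal T=\{x_1,\dots,x_r,y_1,\dots,y_s\}$ of $F|K$ such that $F|K(\mathcal T)$ is separable, with $vK(\mathcal T)=vK\oplus\bigoplus_{1\le i\le r}\mathbb Z\,vx_i$ and $K(\mathcal T)v=Kv(y_1v,\dots,y_sv)$. If, in addition, $vF/vK$ is torsion free and $Fv|Kv$ is separable, then $\mathcal T$ can be chosen to additionally satisfy $vK(\mathcal T)=vF$ and $Fv|K(\mathcal T)v$ separable.
   Context: For a valued field $(K,v)$, $vK$ is the value group, $Kv$ the residue field and $av$ the residue of $a$. A field extension $L|K$ is separable if (in characteristic $p>0$) $L$ and $K^{1/p}$ are linearly disjoint over $K$; in characteristic $0$ every extension is separable. For $(F|K,v)$ with $F|K$ of finite transcendence degree, $\operatorname{trdeg}F|K\ge\operatorname{trdeg}Fv|Kv+\dim_{\mathbb Q}\mathbb Q\otimes(vF/vK)$; the extension is without transcendence defect if equality holds. *)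

(* Defs.v *)
From HB Require Import structures.
From mathcomp Require Import all_boot all_order all_algebra.
From mathcomp Require Import mpoly.
Set Implicit Arguments. Unset Strict Implicit. Unset Printing Implicit Defensive.
Import Order.TTheory GRing.Theory Num.Theory.
Local Open Scope ring_scope.

Section ValuedFieldDefs.
Variable F : fieldType.

Definition is_subfield (E : F -> Prop) : Prop :=
  [/\ E 1, (forall a b, E a -> E b -> E (a - b)),
      (forall a b, E a -> E b -> E (a * b)) & (forall a, E a -> E a^-1)].

(* A valuation on F is given by its valuation ring O. *)
Definition is_valring (O : F -> Prop) : Prop :=
  [/\ O 1, (forall a b, O a -> O b -> O (a - b)),
      (forall a b, O a -> O b -> O (a * b)) &
      (forall x, x != 0 -> O x \/ O x^-1)].

Definition vmax (O : F -> Prop) (x : F) : Prop := O x /\ (x = 0 \/ ~ O x^-1).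
Definition vunit (O : F -> Prop) (u : F) : Prop := [/\ u != 0, O u & O u^-1].

Definition adjoin (K S : F -> Prop) (z : F) : Prop :=
  forall E, is_subfield E -> (forall a, K a -> E a) -> (forall a, S a -> E a) -> E z.

Definition frange n (t : 'I_n -> F) (a : F) : Prop := exists i, t i = a.

Definition catf r s (x : 'I_r -> F) (y : 'I_s -> F) (i : 'I_(r + s)) : F :=
  match split i with inl j => x j | inr j => y j end.

Definition fin_generated (K : F -> Prop) : Prop :=
  exists n (a : 'I_n -> F), forall z, adjoin K (frange a) z.

Definition alg_indep (K : F -> Prop) n (t : 'I_n -> F) : Prop :=
  forall f : {mpoly F[n]}, (forall m, K f@_m) -> f.@[t] = 0 -> f = 0.

Definition algebraic_over (E : F -> Prop) (z : F) : Prop :=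
  exists p : {poly F}, [/\ p != 0, (forall i, E p`_i) & root p z].

Definition trbasis (K : F -> Prop) n (t : 'I_n -> F) : Prop :=
  alg_indep K t /\ forall z, algebraic_over (adjoin K (frange t)) z.

Definition lin_indep (E : F -> Prop) n (y : 'I_n -> F) : Prop :=
  forall c : 'I_n -> F, (forall i, E (c i)) ->
    \sum_i c i * y i = 0 -> forall i, c i = 0.

(* F|E separable: E^{1/p} and F linearly disjoint over E, transported by
   Frobenius: F^p and E linearly disjoint over E^p. *)
Definition separable_over (E : F -> Prop) : Prop :=
  forall p, p \in [pchar F] -> forall n (y : 'I_n -> F),
    lin_indep E y -> lin_indep E (fun i => y i ^+ p).

Definition in_vK (K O : F -> Prop) (z : F) : Prop :=
  exists c, [/\ K c, c != 0 & vunit O (z / c)].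

(* va_1,...,va_n are Z-linearly (equivalently Q-linearly) independent in vF/vK *)
Definition vindep (K O : F -> Prop) n (a : 'I_n -> F) : Prop :=
  forall m : 'I_n -> int, in_vK K O (\prod_i a i ^ m i) -> forall i, m i = 0.

Definition ratrank_eq (K O : F -> Prop) (r : nat) : Prop :=
  (exists a : 'I_r -> F, (forall i, a i != 0) /\ vindep K O a) /\
  (forall b : 'I_r.+1 -> F, (forall i, b i != 0) -> ~ vindep K O b).

Definition res_alg_indep (K O : F -> Prop) n (y : 'I_n -> F) : Prop :=
  forall f : {mpoly F[n]}, (forall m, K f@_m /\ O f@_m) ->
    (exists m, ~ vmax O f@_m) -> ~ vmax O f.@[y].

Definition res_trdeg_eq (K O : F -> Prop) (s : nat) : Prop :=
  (exists y : 'I_s -> F, (forall i, O (y i)) /\ res_alg_indep K O y) /\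
  (forall y : 'I_s.+1 -> F, (forall i, O (y i)) -> ~ res_alg_indep K O y).

Definition res_lin_indep (E O : F -> Prop) n (y : 'I_n -> F) : Prop :=
  forall c : 'I_n -> F, (forall i, E (c i) /\ O (c i)) ->
    vmax O (\sum_i c i * y i) -> forall i, vmax O (c i).

(* Fv|Ev separable (char Fv = p iff p%:R lies in the maximal ideal) *)
Definition res_separable (E O : F -> Prop) : Prop :=
  forall p, prime p -> vmax O p%:R -> forall n (y : 'I_n -> F),
    (forall i, O (y i)) -> res_lin_indep E O y ->
    res_lin_indep E O (fun i => y i ^+ p).

Definition vtorsion_free (K O : F -> Prop) : Prop :=
  forall z, z != 0 -> forall n, (0 < n)%N -> in_vK K O (z ^+ n) -> in_vK K O z.

Definition vgroup_sum (K E O : F -> Prop) r (x : 'I_r -> F) : Prop :=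
  vindep K O x /\
  forall z, E z -> z != 0 ->
    exists m : 'I_r -> int, in_vK K O (z / \prod_i x i ^ m i).

Definition resfield_gen (K E O : F -> Prop) s (y : 'I_s -> F) : Prop :=
  (forall i, O (y i)) /\
  (forall z, E z -> O z ->
     exists f g : {mpoly F[s]},
       [/\ (forall m, K f@_m /\ O f@_m), (forall m, K g@_m /\ O g@_m),
           vunit O g.@[y] & vmax O (z - f.@[y] / g.@[y])]) /\
  (forall f g : {mpoly F[s]},
     (forall m, K f@_m /\ O f@_m) -> (forall m, K g@_m /\ O g@_m) ->
     vunit O g.@[y] ->
     exists z, [/\ E z, O z & vmax O (z - f.@[y] / g.@[y])]).

Definition vgroup_full (E O : F -> Prop) : Prop :=
  forall z, z != 0 -> exists w, [/\ E w, w != 0 & vunit O (z / w)].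

End ValuedFieldDefs.

(* Main.v *)
Require Import Defs.
From HB Require Import structures.
From mathcomp Require Import all_boot all_order all_algebra.
From mathcomp Require Import boolp mpoly ring.
Set Implicit Arguments. Unset Strict Implicit. Unset Printing Implicit Defensive.
Import GRing.Theory.
Local Open Scope ring_scope.

(** Start from x whose values are independent over vK and y whose residues are
    algebraically independent over Kv, with r + s = trdeg F|K elements in all.  A
    polynomial in x, y over K is, up to a factor 1 + (element of positive value),
    c x^e g(y) for a single exponent e; hence x, y is a transcendence basis, with
    the value group and residue field of K(x, y) as required.  The same holds for
    any x', y' with v(x'_i - x_i) > v(x_i) and v(y'_i - y_i) > 0.

    In characteristic p, separability of F|K bounds the p-degree of F over K F^p
    by p^(r+s).  If v is nontrivial, elements z u^p can be made arbitrarily small,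
    and adding such elements to the x_i, y_i one at a time makes them
    p-independent over K F^p; then F = K(x', y') F^p, so that F|K(x', y') is
    separable.  If v is trivial, any separating transcendence basis will do.

    For the last part, x is first chosen as a basis of vF/vK (torsion free, and
    finitely generated since (vF : vK(x, y)) <= [F : K(x, y)]), and y as a lift of
    a separating transcendence basis of the finitely generated extension Fv|Kv. *)

(** * Linear algebra over a subfield *)

(** Separability is handled by linear algebra, without derivations. If [F : E] is finite, it
    suffices to raise a basis of F over E to the p-th power: the powers are independent as soon as
    they span F, and they span F when F = E F^p. What remains is to bound the number of
    p-independent elements of F over K F^p. This is possible because F^p is a copy of F:
    separability of F|K makes [K F^p : K(T^p)] at least [F : K(T)], while [F : K(T^p)] is at most
    p^(r+s) [F : K(T)]. A field N containing K F^p contains z u^p, for u nonzero, exactly when it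
    contains z. So z can be taken outside N first and u chosen small afterwards; smallness and
    p-independence never compete. This freedom disappears when the valuation is trivial, but then r
    = 0 and every element is its own residue, so that values and residues impose no condition on a
    transcendence basis. *)

Lemma big_option (V : nmodType) (I : finType) (G : option I -> V) :
  \sum_o G o = G None + \sum_i G (Some i).
Proof.
rewrite (bigD1 None) //=; congr (_ + _).
rewrite (reindex_omap (@Some I) id) => [|[i|] //].
by apply: eq_bigl => i; rewrite eqxx.
Qed.

Section Subfield.
Variables (F : fieldType) (E : F -> Prop) (sE : is_subfield E).

Lemma subfield1 : E 1. Proof. by case: sE. Qed.

Lemma subfieldB a b : E a -> E b -> E (a - b).
Proof. by case: sE => _ h _ _; apply: h. Qed.

Lemma subfield0 : E 0.
Proof. by rewrite -(subrr 1); apply: subfieldB; apply: subfield1. Qed.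

Lemma subfieldN a : E a -> E (- a).
Proof. by rewrite -[- a]add0r => Ea; apply: subfieldB => //; apply: subfield0. Qed.

Lemma subfieldD a b : E a -> E b -> E (a + b).
Proof. by move=> Ea Eb; rewrite -[b]opprK; apply: subfieldB => //; apply: subfieldN. Qed.

Lemma subfieldM a b : E a -> E b -> E (a * b).
Proof. by case: sE => _ _ h _; apply: h. Qed.

Lemma subfieldV a : E a -> E a^-1.
Proof. by case: sE => _ _ _; apply. Qed.

Lemma subfield_div a b : E a -> E b -> E (a / b).
Proof. by move=> Ea Eb; apply: subfieldM => //; apply: subfieldV. Qed.

Lemma subfieldX a n : E a -> E (a ^+ n).
Proof.
move=> Ea; elim: n => [|n IH]; first by rewrite expr0; apply: subfield1.
by rewrite exprS; apply: subfieldM.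
Qed.

Lemma subfield_exprz a (n : int) : E a -> E (a ^ n).
Proof.
by move=> Ea; case: n => n; [apply: subfieldX | apply: subfieldV; apply: subfieldX].
Qed.

Lemma subfield_nat n : E n%:R.
Proof.
elim: n => [|n IH]; first exact: subfield0.
by rewrite -addn1 natrD; apply: subfieldD => //; apply: subfield1.
Qed.

Lemma subfield_sum I (r : seq I) (P : pred I) (G : I -> F) :
  (forall i, P i -> E (G i)) -> E (\sum_(i <- r | P i) G i).
Proof. by move=> h; apply: big_ind => //; [apply: subfield0 | apply: subfieldD]. Qed.

Lemma subfield_prod I (r : seq I) (P : pred I) (G : I -> F) :
  (forall i, P i -> E (G i)) -> E (\prod_(i <- r | P i) G i).
Proof. by move=> h; apply: big_ind => //; [apply: subfield1 | apply: subfieldM]. Qed.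

End Subfield.

(** The proof of [is_subfield E] is an argument so that the closure properties can be attached to
    this predicate as a canonical instance. *)
Definition subfieldb (F : fieldType) (E : F -> Prop) & is_subfield E : {pred F} :=
  [pred x | `[< E x >]].

Section SubfieldType.
Variables (F : fieldType) (E : F -> Prop) (sE : is_subfield E).

Fact subfieldb_divring : divring_closed (subfieldb sE).
Proof.
split => [|a b|a b]; rewrite !inE; first by apply/asboolP; apply: subfield1.
  by move=> /asboolP ha /asboolP hb; apply/asboolP; apply: subfieldB.
by move=> /asboolP ha /asboolP hb; apply/asboolP; apply: subfield_div.
Qed.

HB.instance Definition _ :=
  GRing.isDivringClosed.Build F (subfieldb sE) subfieldb_divring.

Inductive subfield_sort := SubfieldElt x & x \in subfieldb sE.
Definition subfield_val u := let: SubfieldElt x _ := u in x.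

HB.instance Definition _ := [isSub for subfield_val].
HB.instance Definition _ := [Choice of subfield_sort by <:].
HB.instance Definition _ := [SubChoice_isSubIntegralDomain of subfield_sort by <:].
HB.instance Definition _ := [SubIntegralDomain_isSubField of subfield_sort by <:].

End SubfieldType.

(* Lets matrices and polynomials with coefficients in the subfield E be
   treated as objects over a field type. *)
Lemma subfield_fieldType (F : fieldType) (E : F -> Prop) : is_subfield E ->
  exists (L : fieldType) (i : {rmorphism L -> F}), forall z, E z <-> exists a, z = i a.
Proof.
move=> sE; exists (subfield_sort sE : fieldType), (\val : {rmorphism _ -> _}) => z.
split => [Ez | [a ->]].
  have h : z \in subfieldb sE by rewrite inE; apply/asboolP.
  by exists (SubfieldElt h).
by case: a => x /= /[!inE] /asboolP.
Qed.

Section LinearAlgebra.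
Variable F : fieldType.
Implicit Types (E : F -> Prop) (I J : finType).

(** [lin_indep] with an arbitrary finite index type: products then index towers, and [option]
    indexes one-element extensions. *)
Definition free_fam E I (y : I -> F) : Prop :=
  forall c : I -> F, (forall i, E (c i)) -> \sum_i c i * y i = 0 -> forall i, c i = 0.

Definition spanned E I (y : I -> F) (z : F) : Prop :=
  exists2 c : I -> F, forall i, E (c i) & z = \sum_i c i * y i.

(** Otherwise the matrix expressing the [y i] through the [b j] has more rows than columns, and a
    nonzero row vector that kills it is a relation between the [y i]. *)
Lemma free_fam_leq E I J (y : I -> F) (b : J -> F) : is_subfield E ->
  free_fam E y -> (forall i, spanned E b (y i)) -> (#|I| <= #|J|)%N.
Proof.
move=> sE fy sy; rewrite leqNgt; apply/negP => ltJI.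
have [L [f fE]] := subfield_fieldType sE.
have /choice [c hc] : forall i, exists c : J -> L, y i = \sum_j f (c j) * b j.
  move=> i; have [c Ec ->] := sy i.
  have /choice [d hd] : forall j, exists a, c j = f a by move=> j; apply/fE.
  by exists d; apply: eq_bigr => j _; rewrite hd.
pose A := \matrix_(k < #|I|, l < #|J|) c (enum_val k) (enum_val l).
have /row_freePn [k0 /submxP [D hD]] : ~~ row_free A.
  by rewrite /row_free neq_ltn (leq_ltn_trans (rank_leq_col A)).
have : kermx A != 0.
  rewrite kermx_eq0 /row_free neq_ltn.
  by rewrite (leq_ltn_trans (rank_leq_col A)).
case/rowV0Pn => u /sub_kermxP uA u0.
case/eqP: u0; apply/rowP => k; rewrite [RHS]mxE.
apply: (fmorph_inj f); rewrite rmorph0 -[k]enum_valK.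
apply: (fy (fun i => f (u 0 (enum_rank i)))) => [i|]; first by apply/fE; exists (u 0 (enum_rank i)).
under eq_bigr => i _ do rewrite hc mulr_sumr.
rewrite exchange_big big1 //= => j _.
under eq_bigr => i _ do rewrite mulrA -rmorphM.
rewrite -mulr_suml -rmorph_sum.
have /rowP/(_ (enum_rank j)) := uA; rewrite !mxE => h.
have -> : \sum_(i : I) u 0 (enum_rank i) * c i j = 0; last by rewrite rmorph0 mul0r.
rewrite -[RHS]h (reindex_onto (@enum_val _ I) (fun i => enum_rank i)) /=; last first.
  by move=> i _; rewrite enum_rankK.
apply: eq_big => [i|i _]; first by rewrite enum_valK eqxx.
by rewrite !mxE enum_valK enum_rankK.
Qed.

Lemma spanned_memb E I (y : I -> F) i : is_subfield E -> spanned E y (y i).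
Proof.
move=> sE; exists (fun j => (j == i)%:R) => [j|]; first exact: subfield_nat.
rewrite (bigD1 i) //= eqxx mul1r big1 ?addr0 // => j /negbTE ->.
by rewrite mul0r.
Qed.

Lemma spanned0 E I (y : I -> F) : is_subfield E -> spanned E y 0.
Proof.
move=> sE; exists (fun=> 0) => [_|]; first exact: subfield0.
by rewrite big1 // => i _; rewrite mul0r.
Qed.

Lemma spannedD E I (y : I -> F) a b : is_subfield E ->
  spanned E y a -> spanned E y b -> spanned E y (a + b).
Proof.
move=> sE [c Ec ->] [d Ed ->]; exists (fun i => c i + d i) => [i|].
  exact: subfieldD.
by rewrite -big_split; apply: eq_bigr => i _; rewrite mulrDl.
Qed.

Lemma spannedZ E I (y : I -> F) e a : is_subfield E ->
  E e -> spanned E y a -> spanned E y (e * a).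
Proof.
move=> sE Ee [c Ec ->]; exists (fun i => e * c i) => [i|].
  exact: subfieldM.
by rewrite mulr_sumr; apply: eq_bigr => i _; rewrite mulrA.
Qed.

Lemma spanned_sum E I (y : I -> F) T (r : seq T) (P : pred T) (G : T -> F) :
  is_subfield E -> (forall i, P i -> spanned E y (G i)) ->
  spanned E y (\sum_(i <- r | P i) G i).
Proof. by move=> sE h; apply: big_ind => //; [apply: spanned0 | move=> a b; apply: spannedD]. Qed.

Lemma spanned_trans E I J (y : I -> F) (b : J -> F) z : is_subfield E ->
  spanned E y z -> (forall i, spanned E b (y i)) -> spanned E b z.
Proof.
by move=> sE [c Ec ->] h; apply: spanned_sum => // i _; apply: spannedZ.
Qed.

Lemma free_fam_extend E I (y : I -> F) z : is_subfield E ->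
  free_fam E y -> ~ spanned E y z -> free_fam E (oapp y z).
Proof.
move=> sE fy nz c Ec; rewrite big_option /= => h.
have c0 : c None = 0.
  apply: contrapT => /eqP c0; case: nz; exists (fun i => - (c None)^-1 * c (Some i)).
    by move=> i; apply: subfieldM => //; apply: subfieldN => //; apply: subfieldV.
  under eq_bigr => i _ do rewrite mulNr mulNr -mulrA.
  rewrite sumrN -mulr_sumr; apply: (mulfI c0).
  by rewrite mulrN mulVKf //; apply/eqP; rewrite -addr_eq0 h.
move: h; rewrite c0 mul0r add0r => h [i|//].
exact: (fy (fun i => c (Some i))).
Qed.

Lemma free_fam_of_spanning E I J (y : I -> F) (b : J -> F) : is_subfield E ->
  free_fam E y -> (forall i, spanned E b (y i)) -> (#|J| <= #|I|)%N -> free_fam E b.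
Proof.
move=> sE fy sy leJI c Ec h j0; apply: contrapT => /eqP c0.
pose b' (j : {j in predC1 j0}) := b (val j).
have sb j : spanned E b' (b j).
  have [->{j}|nj] := eqVneq j j0; last first.
    by have := spanned_memb b' (exist _ j nj : {j in predC1 j0}) sE.
  exists (fun j => - (c j0)^-1 * c (val j)).
    by move=> j; apply: subfieldM => //; apply: subfieldN => //; apply: subfieldV.
  under eq_bigr => i _ do rewrite mulNr mulNr -mulrA.
  rewrite sumrN -mulr_sumr; apply: (mulfI c0).
  rewrite mulrN mulVKf //; apply/eqP; rewrite -addr_eq0 -[X in _ == X]h (bigD1 j0) //=.
  by rewrite (big_sub (predC1 j0) (fun j => c j * b j)).
have := free_fam_leq sE fy (fun i => spanned_trans sE (sy i) sb).
rewrite card_sig; have := leq_trans leJI _ => /[apply].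
rewrite (cardD1 j0 predT) inE /= add1n ltnNge; case/negP.
by apply/subset_leq_card/subsetP => j; rewrite !inE andbT.
Qed.

Lemma free_fam_inj E I J (y : I -> F) (h : J -> I) : is_subfield E -> injective h ->
  free_fam E y -> free_fam E (fun j => y (h j)).
Proof.
move=> sE hi fy c Ec sc j.
pose c' i := \sum_(j | h j == i) c j.
have <- : c' (h j) = c j.
  by rewrite /c' (eq_bigl (pred1 j)) ?big_pred1_eq // => k; rewrite /= (inj_eq hi).
apply: fy => [i|]; first by apply: subfield_sum.
rewrite -[RHS]sc [RHS](partition_big h predT) //=.
apply: eq_bigr => i _; rewrite /c' mulr_suml.
by apply: eq_bigr => k /eqP ->.
Qed.

Lemma free_fam_tower E E' I J (e : I -> F) (f : J -> F) :
  (forall a, E a -> E' a) -> is_subfield E' -> (forall i, E' (e i)) ->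
  free_fam E e -> free_fam E' f -> free_fam E (fun k : I * J => e k.1 * f k.2).
Proof.
move=> EE' sE' Ee fe ff c Ec h [i j].
apply: (fe (fun i => c (i, j))) => //.
apply: (ff (fun j => \sum_i c (i, j) * e i)) => {i j}[j|].
  by apply: subfield_sum => // i _; apply: subfieldM => //; apply: EE'.
have {}h : \sum_i \sum_j c (i, j) * (e i * f j) = 0.
  by rewrite pair_bigA -[RHS]h; apply: eq_bigr => -[].
rewrite -[RHS]h exchange_big /=.
by apply: eq_bigr => j _; rewrite mulr_suml; apply: eq_bigr => i _; rewrite mulrA.
Qed.

Lemma spanned_tower E E' I J (e : I -> F) (f : J -> F) z :
  (forall a, E' a -> spanned E e a) -> spanned E' f z ->
  spanned E (fun k : I * J => e k.1 * f k.2) z.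
Proof.
move=> h [c E'c ->].
have /choice [d hd] : forall j, exists d : I -> F,
    (forall i, E (d i)) /\ c j = \sum_i d i * e i.
  by move=> j; have [d Ed ->] := h _ (E'c j); exists d.
exists (fun k => d k.2 k.1) => [k|]; first by case: (hd k.2).
rewrite -(pair_bigA _ (fun i j => d j i * (e i * f j))) exchange_big /=.
apply: eq_bigr => j _; case: (hd j) => _ ->; rewrite mulr_suml.
by apply: eq_bigr => i _; rewrite mulrA.
Qed.

Lemma exists_basis_bounded E N : is_subfield E ->
  (forall I (y : I -> F), free_fam E y -> (#|I| <= N)%N) ->
  exists (I : finType) (f : I -> F), free_fam E f /\ forall z, spanned E f z.
Proof.
move=> sE hN.
(* [k] limits how many elements can still be added: from the empty family and [k = N.+1], the bound
   [N] is violated before [k] is used up. *)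
suff: forall k I (f : I -> F), free_fam E f -> (N < #|I| + k)%N ->
    exists (I : finType) (f : I -> F), free_fam E f /\ forall z, spanned E f z.
  move/(_ N.+1 void (fun=> 0)); apply; last by rewrite card_void.
  by move=> c _ _ [].
elim=> [|k IH] I f ff; first by rewrite addn0 ltnNge (hN _ _ ff).
case: (EM (forall z, spanned E f z)) => [sf _|]; first by exists I, f.
move/existsNP => [z nz] lt; apply: (IH _ _ (free_fam_extend sE ff nz)).
by rewrite card_option addSnnS.
Qed.

(** The basis is nonempty because it spans [1]. Positivity of the degree is what allows it to be
    cancelled in [p_chain_leq]. *)
Lemma exists_basis E J (b : J -> F) : is_subfield E -> (forall z, spanned E b z) ->
  exists (I : finType) (f : I -> F),
    [/\ (0 < #|I|)%N, free_fam E f & forall z, spanned E f z].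
Proof.
move=> sE sb.
have [|I [f [ff sf]]] := @exists_basis_bounded E #|J| sE.
  by move=> I y fy; apply: (free_fam_leq sE fy) => i.
exists I, f; split => //; have [c _] := sf 1.
case: (posnP #|I|) => // /card0_eq I0 h.
by move: h; rewrite big_pred0 ?(rwP eqP) ?oner_eq0 // => i; have := I0 i.
Qed.

End LinearAlgebra.

(** * Adjunction and algebraic elements *)

Section Adjoin.
Variable F : fieldType.
Implicit Types (E K : F -> Prop) (S : seq F).

Lemma adjoin_subfield K (A : F -> Prop) : is_subfield (adjoin K A).
Proof.
split=> [|a b ha hb|a b ha hb|a ha] E sE KE AE.
- exact: subfield1.
- by apply: subfieldB => //; [apply: ha | apply: hb].
- by apply: subfieldM => //; [apply: ha | apply: hb].
- by apply: subfieldV => //; apply: ha.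
Qed.

Lemma adjoin_base K (A : F -> Prop) a : K a -> adjoin K A a.
Proof. by move=> Ka E _ h _; apply: h. Qed.

Lemma adjoin_gen K (A : F -> Prop) a : A a -> adjoin K A a.
Proof. by move=> Aa E _ _; apply. Qed.

Definition adj K S := adjoin K (fun z => z \in S).

Lemma adj_subfield K S : is_subfield (adj K S).
Proof. exact: adjoin_subfield. Qed.

Lemma adj_base K S a : K a -> adj K S a. Proof. exact: adjoin_base. Qed.

Lemma adj_gen K S a : a \in S -> adj K S a. Proof. exact: adjoin_gen. Qed.

Lemma adj_min K S E : is_subfield E -> (forall a, K a -> E a) ->
  (forall a, a \in S -> E a) -> forall a, adj K S a -> E a.
Proof. by move=> sE KE SE a; apply. Qed.

Lemma adj_sub K S S' : {subset S <= S'} -> forall a, adj K S a -> adj K S' a.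
Proof.
move=> ss; apply: adj_min; first exact: adj_subfield.
  by move=> a; apply: adj_base.
by move=> a /ss; apply: adj_gen.
Qed.

Lemma adj_subl K K' S : (forall a, K a -> K' a) -> forall a, adj K S a -> adj K' S a.
Proof.
move=> KK; apply: adj_min; first exact: adj_subfield.
  by move=> a /KK; apply: adj_base.
by move=> a; apply: adj_gen.
Qed.

Lemma adj_nil K : is_subfield K -> adj K [::] = K.
Proof.
move=> sK; rewrite predeqE => z; split; last exact: adj_base.
by apply: adj_min.
Qed.

Lemma adj_cat K S S' : adj K (S ++ S') = adj (adj K S) S'.
Proof.
rewrite predeqE => z; split.
  apply: adj_min => [|a Ka|a]; first exact: adj_subfield.
    by do 2 apply: adj_base.
  rewrite mem_cat => /orP [h|h]; last exact: adj_gen.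
  by apply: adj_base; apply: adj_gen.
apply: adj_min => [|a|a h]; first exact: adj_subfield.
  by apply: adj_sub => b hb; rewrite mem_cat hb.
by apply: adj_gen; rewrite mem_cat h orbT.
Qed.

Lemma eq_adj K S S' : S =i S' -> adj K S = adj K S'.
Proof.
by move=> h; rewrite predeqE => z; split; apply: adj_sub => a; rewrite h.
Qed.

Lemma adj_cons K a S : adj K (a :: S) = adj (adj K S) [:: a].
Proof. by rewrite -adj_cat; apply: eq_adj => z; rewrite mem_cat !inE orbC. Qed.

Lemma adj_cons_base K a S : adj K (a :: S) = adj (adj K [:: a]) S.
Proof. by rewrite -adj_cat. Qed.

Lemma adjoin_frange K n (t : 'I_n -> F) : adjoin K (frange t) = adj K (codom t).
Proof.
rewrite /adj; congr adjoin; rewrite predeqE => z; split => [[i <-]|/codomP [i ->]].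
  exact: codom_f.
by exists i.
Qed.

End Adjoin.

(** * Polynomials with coefficients in a subfield *)

Section PolyOver.
Variables (F : fieldType) (E : F -> Prop) (sE : is_subfield E).
Implicit Types p q : {poly F}.

Definition poly_over p : Prop := forall i, E p`_i.

Lemma poly_over0 : poly_over 0.
Proof. by move=> i; rewrite coef0; apply: subfield0. Qed.

Lemma poly_overC c : E c -> poly_over c%:P.
Proof. by move=> Ec i; rewrite coefC; case: ifP => // _; apply: subfield0. Qed.

Lemma poly_overX : poly_over 'X.
Proof. by move=> i; rewrite coefX; apply: subfield_nat. Qed.

Lemma poly_overD p q : poly_over p -> poly_over q -> poly_over (p + q).
Proof. by move=> hp hq i; rewrite coefD; apply: subfieldD. Qed.

Lemma poly_overN p : poly_over p -> poly_over (- p).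
Proof. by move=> hp i; rewrite coefN; apply: subfieldN. Qed.

Lemma poly_overM p q : poly_over p -> poly_over q -> poly_over (p * q).
Proof.
move=> hp hq i; rewrite coefM; apply: subfield_sum => // j _; exact: subfieldM.
Qed.

Lemma poly_overZ c p : E c -> poly_over p -> poly_over (c *: p).
Proof. by move=> Ec hp i; rewrite coefZ; apply: subfieldM. Qed.

Lemma poly_over_sum I (r : seq I) (P : pred I) (G : I -> {poly F}) :
  (forall i, P i -> poly_over (G i)) -> poly_over (\sum_(i <- r | P i) G i).
Proof. by move=> h; apply: big_ind => //; [apply: poly_over0 | apply: poly_overD]. Qed.

Lemma poly_over_prod I (r : seq I) (P : pred I) (G : I -> {poly F}) :
  (forall i, P i -> poly_over (G i)) -> poly_over (\prod_(i <- r | P i) G i).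
Proof.
move=> h; apply: big_ind => //; last exact: poly_overM.
by apply: poly_overC; apply: subfield1.
Qed.

Lemma poly_overXn p n : poly_over p -> poly_over (p ^+ n).
Proof. by move=> hp; rewrite -[n]subn0 -prodr_const_nat; apply: poly_over_prod. Qed.

Lemma poly_over_comp p q : poly_over p -> poly_over q -> poly_over (p \Po q).
Proof.
move=> hp hq; rewrite comp_polyE; apply: poly_over_sum => i _.
by apply: poly_overZ => //; apply: poly_overXn.
Qed.

Lemma adj1_frac a z : adj E [:: a] z ->
  exists p q, [/\ poly_over p, poly_over q, q.[a] != 0 & z = p.[a] / q.[a]].
Proof.
have o1 := poly_overC (subfield1 sE).
pose G z := exists p q, [/\ poly_over p, poly_over q, q.[a] != 0 & z = p.[a] / q.[a]].
move: z; apply: (adj_min (E := G)) => [|c Ec|c].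
- split.
  + by exists 1, 1; rewrite hornerC oner_eq0 divr1.
  + move=> _ _ [p [q [hp hq q0 ->]]] [p' [q' [hp' hq' q'0 ->]]].
    exists (p * q' - p' * q), (q * q'); split.
    * by apply: poly_overD; [|apply: poly_overN]; apply: poly_overM.
    * exact: poly_overM.
    * by rewrite hornerM mulf_neq0.
    * by rewrite !hornerE -mulNr addf_div // mulNr.
  + move=> _ _ [p [q [hp hq q0 ->]]] [p' [q' [hp' hq' q'0 ->]]].
    exists (p * p'), (q * q'); split; rewrite ?hornerM ?mulf_neq0 //.
    * exact: poly_overM.
    * exact: poly_overM.
    * by rewrite mulf_div.
  + move=> _ [p [q [hp hq q0 ->]]].
    have [p0|p0] := eqVneq p.[a] 0.
      exists 0, 1; rewrite p0 !hornerC oner_eq0 mul0r invr0 mul0r.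
      by split => //; apply: poly_over0.
    by exists q, p; rewrite invf_div.
- by exists c%:P, 1; rewrite !hornerC oner_eq0 divr1; split => //; apply: poly_overC.
- rewrite inE => /eqP ->; exists 'X, 1; rewrite hornerX hornerC oner_eq0 divr1.
  by split => //; apply: poly_overX.
Qed.

Lemma adj1_common_denom (I : finType) a (c : I -> F) : (forall i, adj E [:: a] (c i)) ->
  exists (p : I -> {poly F}) q,
    [/\ forall i, poly_over (p i), poly_over q, q.[a] != 0 &
        forall i, c i = (p i).[a] / q.[a]].
Proof.
move=> hc.
have /choice [g hg] : forall i, exists pq : {poly F} * {poly F},
    [/\ poly_over pq.1, poly_over pq.2, pq.2.[a] != 0 & c i = pq.1.[a] / pq.2.[a]].
  by move=> i; have [p [q h]] := adj1_frac (hc i); exists (p, q).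
exists (fun i => (g i).1 * \prod_(j | j != i) (g j).2), (\prod_j (g j).2); split.
- move=> i; apply: poly_overM; first by case: (hg i).
  by apply: poly_over_prod => j _; case: (hg j).
- by apply: poly_over_prod => j _; case: (hg j).
- by rewrite horner_prod; apply/prodf_neq0 => j _; case: (hg j).
- move=> i; rewrite [X in _ / X.[a]](bigD1 i) //= !hornerM -mulf_div divff ?mulr1.
    by case: (hg i).
  by rewrite horner_prod; apply/prodf_neq0 => j _; case: (hg j).
Qed.

End PolyOver.

(** * Algebraic elements and finite extensions *)

Section Algebraic.
Variable F : fieldType.
Implicit Types (E K : F -> Prop) (S : seq F).

Lemma algebraic_sub E E' z : (forall a, E a -> E' a) ->
  algebraic_over E z -> algebraic_over E' z.
Proof. by move=> h [p [p0 Ep pz]]; exists p; split => // i; apply: h. Qed.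

Lemma algebraic_memb E z : is_subfield E -> E z -> algebraic_over E z.
Proof.
move=> sE Ez; exists ('X - z%:P); split; first by rewrite polyXsubC_eq0.
  by apply: poly_overD => //; [apply: poly_overX | apply: poly_overN => //; apply: poly_overC].
by rewrite root_XsubC.
Qed.

(** One power more than [b] has members cannot be free, and a relation between powers of [z] is a
    polynomial equation. *)
Lemma algebraic_of_spanned E (J : finType) (b : J -> F) z : is_subfield E ->
  (forall i, spanned E b (z ^+ i)) -> algebraic_over E z.
Proof.
move=> sE sz.
have : ~ free_fam E (fun i : 'I_#|J|.+1 => z ^+ i).
  by move=> /(free_fam_leq sE) /(_ (fun i => sz i)); rewrite card_ord ltnn.
move/existsNP => [c /not_implyP [Ec /not_implyP [c0 /existsNP [i ci]]]].
exists (\poly_(k < #|J|.+1) c (inord k)); split.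
- by apply/eqP => /polyP/(_ i); rewrite coef_poly ltn_ord inord_val coef0.
- by move=> k; rewrite coef_poly; case: ifP => // _; apply: subfield0.
rewrite /root horner_poly -[X in _ == X]c0; apply/eqP.
by apply: eq_bigr => k _; rewrite inord_val.
Qed.

(** After dividing by powers of ['X] the equation has the form p(z) z + c = 0 with c nonzero, and
    then z^-1 = - p(z) / c. *)
Lemma algebraic_inv E z : is_subfield E -> algebraic_over E z ->
  exists2 q, poly_over E q & z^-1 = q.[z].
Proof.
move=> sE [p [p0 Ep pz]].
have [->|z0] := eqVneq z 0.
  by exists 0; rewrite ?invr0 ?horner0 //; apply: poly_over0.
elim/poly_ind: p p0 Ep pz => [|p c IH] p0 Ep; first by rewrite eqxx in p0.
have Ep' : poly_over E p by move=> i; have := Ep i.+1; rewrite coefD coefMX coefC /= addr0.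
rewrite /root !hornerE.
have [c0|c0] := eqVneq c 0.
  rewrite c0 addr0 mulf_eq0 (negbTE z0) orbF => pz; apply: IH => //.
  by apply: contraNneq p0 => ->; rewrite c0 mul0r addr0.
rewrite addr_eq0 => /eqP pz; exists (- c^-1 *: p).
  apply: poly_overZ => //; apply: subfieldN => //; apply: subfieldV => //.
  by have := Ep 0%N; rewrite coefD coefMX coefC /= add0r.
by rewrite hornerZ; apply: (mulIf z0); rewrite mulVf // -mulrA pz mulrNN mulVf.
Qed.

Lemma poly_over_lift (L : fieldType) (f : L -> F) E r : (forall z, E z <-> exists a, z = f a) ->
  f 0 = 0 -> poly_over E r -> exists r' : {poly L}, r = map_poly f r'.
Proof.
move=> fE f0 Er; have /choice [g hg] : forall i, exists a, r`_i = f a by move=> i; apply/fE.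
exists (\poly_(i < size r) g i); apply/polyP => i; rewrite coef_map_id0 // coef_poly.
by case: ltnP => [_ //|h]; rewrite (nth_default _ h) f0.
Qed.

(** [q] is replaced by its remainder modulo [p]. The division takes place over a field type that
    stands for [E], so the remainder keeps its coefficients in [E]. *)
Lemma spanned_horner E z p q : is_subfield E -> p != 0 -> poly_over E p -> root p z ->
  poly_over E q -> spanned E (fun i : 'I_(size p).-1 => z ^+ i) q.[z].
Proof.
move=> sE p0 Ep pz Eq; have [L [f fE]] := subfield_fieldType sE.
have lift := poly_over_lift fE (rmorph0 f).
have [p' ?] := lift _ Ep; have [q' ?] := lift _ Eq; subst p q.
have p'0 : p' != 0 by apply: contraNneq p0 => ->; rewrite rmorph0.
have -> : (map_poly f q').[z] = (map_poly f (q' %% p')).[z].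
  rewrite {1}(divp_eq q' p') rmorphD rmorphM hornerD hornerM.
  by rewrite (eqP pz) mulr0 add0r.
have sz : (size (map_poly f (q' %% p')%R) <= (size (map_poly f p')).-1)%N.
  by rewrite !size_map_poly -ltnS (leq_trans (ltn_modpN0 _ p'0)) // leqSpred.
rewrite (horner_coef_wide _ sz); exists (fun i : 'I__ => (map_poly f (q' %% p'))`_i) => // i.
by rewrite coef_map; apply/fE; exists ((q' %% p')`_i).
Qed.

(** All powers of the denominator are polynomials in [z], so the denominator is algebraic and its
    inverse is again a polynomial in [z]. *)
Lemma adj1_spanned E z p w : is_subfield E -> p != 0 -> poly_over E p -> root p z ->
  adj E [:: z] w -> spanned E (fun i : 'I_(size p).-1 => z ^+ i) w.
Proof.
move=> sE p0 Ep pz /(adj1_frac sE) [a [b [Ea Eb b0 ->]]].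
have /algebraic_inv [//|c Ec ->] : algebraic_over E b.[z].
  apply: (@algebraic_of_spanned E _ (fun i : 'I_(size p).-1 => z ^+ i)) => // i.
  by rewrite -horner_exp; apply: spanned_horner => //; apply: poly_overXn.
rewrite -horner_comp -hornerM; apply: spanned_horner => //.
by apply: poly_overM => //; apply: poly_over_comp.
Qed.

Lemma algebraic_adj_finite E S : is_subfield E -> (forall a, a \in S -> algebraic_over E a) ->
  exists (J : finType) (b : J -> F), forall z, adj E S z -> spanned E b z.
Proof.
move=> sE; elim: S => [|a S IH] h.
  exists unit, (fun=> 1) => z; rewrite adj_nil // => Ez.
  exists (fun=> z) => //; by rewrite big_const card_unit /= mulr1 addr0.
have [|J [b sb]] := IH; first by move=> c cS; apply: h; rewrite inE cS orbT.
have [p [p0 Ep pa]] : algebraic_over (adj E S) a.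
  by apply: (@algebraic_sub E) => [c|]; [apply: adj_base | apply: h; rewrite inE eqxx].
exists (J * 'I_(size p).-1)%type, (fun k : J * 'I__ => b k.1 * a ^+ k.2) => z.
rewrite adj_cons => hz; apply: (@spanned_tower _ E (adj E S) _ _ b (fun k : 'I__ => a ^+ k)) => //.
by apply: adj1_spanned => //; apply: adj_subfield.
Qed.

Lemma algebraic_adj_trans K S S' z : (forall a, a \in S -> algebraic_over (adj K S') a) ->
  algebraic_over (adj K S) z -> algebraic_over (adj K S') z.
Proof.
move=> h zS; have sE := adj_subfield K S'.
have [J [b sb]] := algebraic_adj_finite sE h.
have {zS} [p [p0 Ep pz]] : algebraic_over (adj (adj K S') S) z.
  apply: (algebraic_sub _ zS) => a; apply: adj_subl => {}a; exact: adj_base.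
apply: (@algebraic_of_spanned _ (J * 'I_(size p).-1)%type
  (fun k : J * 'I__ => b k.1 * z ^+ k.2)) => // i.
apply: (@spanned_tower _ _ (adj (adj K S') S) _ _ b (fun k : 'I_(size p).-1 => z ^+ k)) => //.
apply: adj1_spanned => //; first exact: adj_subfield.
by apply: (subfieldX (adj_subfield _ _)); apply: adj_gen; rewrite inE.
Qed.

(** With denominators cleared, the equation of [z] over [E(a)] becomes a polynomial in two variables
    that vanishes at (a, z); read in the other variable it is an equation of [a] over [E(z)]. If the
    latter were zero, each power of [a] would contribute an equation of [z] over [E], and one of
    these is nontrivial. *)
Lemma algebraic_exchange E a z : is_subfield E -> algebraic_over (adj E [:: a]) z ->
  ~ algebraic_over E z -> algebraic_over (adj E [:: z]) a.
Proof.
move=> sE [p [p0 Ep pz]] nz.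
have [P [q [EP Eq q0 hP]]] := adj1_common_denom sE (fun i : 'I_(size p) => Ep i).
have sEz := adj_subfield E [:: z].
exists (\sum_(i < size p) z ^+ i *: P i); split.
- have : lead_coef p != 0 by rewrite lead_coef_eq0.
  rewrite -size_poly_gt0 in p0.
  have lt : ((size p).-1 < size p)%N by rewrite prednK.
  rewrite lead_coefE (hP (Ordinal lt)) mulf_eq0 negb_or => /andP [Pl _].
  apply: contraNneq Pl => h; rewrite [P _](_ : _ = 0) ?horner0 //.
  apply/polyP => k; rewrite coef0; apply: contrapT => /eqP Pk; case: nz.
  exists (\poly_(i < size p) (if insub i is Some j then (P j)`_k else 0)); split.
  + apply: contraNneq Pk => /polyP/(_ (size p).-1).
    by rewrite coef_poly lt coef0 insubT /= => ->.
  + move=> i; rewrite coef_poly; case: ifP => _; last exact: subfield0.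
    by case: insubP => [j _ _|_]; [apply: EP | apply: subfield0].
  + rewrite /root horner_poly; move/polyP/(_ k): h; rewrite coef_sum coef0 => h.
    rewrite -[X in _ == X]h; apply/eqP; apply: eq_bigr => i _.
    by rewrite valK coefZ mulrC.
- apply: poly_over_sum => // i _; apply: poly_overZ => //.
    by apply: (subfieldX sEz); apply: adj_gen; rewrite inE.
  by move=> k; apply: adj_base; apply: EP.
- rewrite /root horner_sum.
  apply/eqP; apply: (mulIf (invr_neq0 q0)); rewrite mul0r -[RHS](eqP pz) [RHS]horner_coef mulr_suml.
  apply: eq_bigr => i _; by rewrite hP hornerZ -[LHS]mulrA mulrC.
Qed.

Lemma algebraic_adj E S z : is_subfield E -> (forall a, a \in S -> algebraic_over E a) ->
  adj E S z -> algebraic_over E z.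
Proof.
move=> sE /(algebraic_adj_finite sE) [J [b sb]] hz.
apply: (algebraic_of_spanned (b := b)) => // i; apply: sb.
exact: (subfieldX (adj_subfield _ _)).
Qed.

Lemma fin_generated_finite K T : fin_generated K -> (forall z, algebraic_over (adj K T) z) ->
  exists (J : finType) (b : J -> F), forall z, spanned (adj K T) b z.
Proof.
move=> [n [g hg]] hT.
have [J [b sb]] := algebraic_adj_finite (adj_subfield K T) (fun a (_ : a \in codom g) => hT a).
exists J, b => z; apply: sb; have := hg z; rewrite adjoin_frange.
by apply: adj_subl => a; apply: adj_base.
Qed.

End Algebraic.

(** * Transcendence bases *)

Section TranscendenceChains.
Variable F : fieldType.
Implicit Types (E K : F -> Prop) (S T : seq F).

(** Algebraic independence built up one element at a time, the newest at the head; hence the [rev]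
    in [alg_indep_chain]. *)
Fixpoint alg_chain K S : Prop :=
  if S is a :: S' then alg_chain K S' /\ ~ algebraic_over (adj K S') a else True.

Lemma algebraic_adj_gen K S a : a \in S -> algebraic_over (adj K S) a.
Proof. by move=> aS; apply: algebraic_memb; [apply: adj_subfield | apply: adj_gen]. Qed.

Lemma algebraic_adj_sub K S S' z : {subset S <= S'} ->
  algebraic_over (adj K S) z -> algebraic_over (adj K S') z.
Proof. by move=> ss; apply: algebraic_sub; apply: adj_sub. Qed.

(** Adding the entries of [T] to [S] from the end of the list, there is one at which [a] becomes
    algebraic. That entry is dropped: the exchange property recovers it from [a]. *)
Lemma steinitz_step K S T a : algebraic_over (adj K (T ++ S)) a ->
  ~ algebraic_over (adj K S) a ->
  exists2 T', size T = (size T').+1 &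
    forall t, t \in T -> algebraic_over (adj K (T' ++ a :: S)) t.
Proof.
move=> + na; elim: T => [|t T IH] /= ha; first by case: na.
case: (EM (algebraic_over (adj K (T ++ S)) a)) => [h|h].
  have [T' sT hT] := IH h; exists (t :: T'); first by rewrite /= sT.
  move=> u; rewrite inE => /orP [/eqP ->|/hT].
    by apply: algebraic_adj_gen; rewrite inE eqxx.
  by apply: algebraic_adj_sub => v hv; rewrite inE hv orbT.
rewrite adj_cons in ha.
have h' := algebraic_exchange (adj_subfield _ _) ha h.
rewrite -adj_cons in h'.
exists T => // u; rewrite inE => /orP [/eqP ->|uT].
  by apply: algebraic_adj_sub h' => v; rewrite inE !mem_cat inE orbCA.
by apply: algebraic_adj_gen; rewrite mem_cat uT.
Qed.

Lemma steinitz_exchange K S T : alg_chain K S ->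
  (forall a, a \in S -> algebraic_over (adj K T) a) ->
  exists2 T', size T = (size T' + size S)%N &
    forall t, t \in T -> algebraic_over (adj K (T' ++ S)) t.
Proof.
elim: S => [|a S IH] /= hS hT.
  exists T; first by rewrite addn0.
  by rewrite cats0; apply: algebraic_adj_gen.
case: hS => chS na.
have [|T1 sT1 hT1] := IH chS; first by move=> b bS; apply: hT; rewrite inE bS orbT.
have ha : algebraic_over (adj K (T1 ++ S)) a.
  by apply: (algebraic_adj_trans hT1); apply: hT; rewrite inE eqxx.
have [T2 sT2 hT2] := steinitz_step ha na.
exists T2; first by rewrite sT1 sT2 addnS.
move=> t /hT1; apply: algebraic_adj_trans => b; rewrite mem_cat => /orP [/hT2 //|bS].
by apply: algebraic_adj_gen; rewrite mem_cat inE bS !orbT.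
Qed.

Lemma alg_chain_leq K S T : alg_chain K S ->
  (forall a, a \in S -> algebraic_over (adj K T) a) -> (size S <= size T)%N.
Proof. by move=> h /(steinitz_exchange h) [T' -> _]; rewrite leq_addl. Qed.

Lemma alg_chain_max K S T z : alg_chain K S ->
  (forall a, algebraic_over (adj K T) a) -> size S = size T -> algebraic_over (adj K S) z.
Proof.
move=> h hT eST; have [T' e hT'] := steinitz_exchange h (fun a _ => hT a).
move/eqP: e; rewrite eST -{1}[size T]add0n eqn_add2r => /eqP/esym/size0nil e.
by rewrite e in hT'; apply: algebraic_adj_trans hT' (hT z).
Qed.

End TranscendenceChains.

(** * Multivariate polynomials with coefficients in a subfield *)

Section MPolyOver.
Variables (F : fieldType) (K : F -> Prop) (sK : is_subfield K).

Definition mpoly_over n (f : {mpoly F[n]}) : Prop := forall m, K f@_m.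

Lemma mpoly_overP n (f : {mpoly F[n]}) : mpoly_over f <-> f \is a mpolyOver n (subfieldb sK).
Proof.
split => [h|/mpolyOverP h m]; last by apply/asboolP; apply: h.
by apply/mpolyOverP => m; apply/asboolP.
Qed.

Lemma adj_mpoly_frac n (t : 'I_n -> F) z : adj K (codom t) z ->
  exists f g, [/\ mpoly_over f, mpoly_over g, g.@[t] != 0 & z = f.@[t] / g.@[t]].
Proof.
pose G z := exists f g, [/\ mpoly_over f, mpoly_over g, g.@[t] != 0 & z = f.@[t] / g.@[t]].
have o1 : mpoly_over (1 : {mpoly F[n]}) by apply/mpoly_overP; apply: rpred1.
move: z; apply: (adj_min (E := G)) => [|c Kc|c /codomP [i ->]].
- split.
  + by exists 1, 1; rewrite meval1 oner_eq0 divr1.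
  + move=> _ _ [p [q [hp hq q0 ->]]] [p' [q' [hp' hq' q'0 ->]]].
    exists (p * q' - p' * q), (q * q'); rewrite !(mevalB, mevalM) mulf_neq0 //.
    move/mpoly_overP: hp; move/mpoly_overP: hq; move/mpoly_overP: hp'; move/mpoly_overP: hq'.
    move=> hq' hp' hq hp; split => //.
    * by apply/mpoly_overP; rewrite rpredB ?rpredM.
    * by apply/mpoly_overP; rewrite rpredM.
    * by rewrite -mulNr addf_div // mulNr.
  + move=> _ _ [p [q [hp hq q0 ->]]] [p' [q' [hp' hq' q'0 ->]]].
    exists (p * p'), (q * q'); rewrite !mevalM mulf_neq0 //.
    move/mpoly_overP: hp; move/mpoly_overP: hq; move/mpoly_overP: hp'; move/mpoly_overP: hq'.
    move=> hq' hp' hq hp; split => //.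
    * by apply/mpoly_overP; rewrite rpredM.
    * by apply/mpoly_overP; rewrite rpredM.
    * by rewrite mulf_div.
  + move=> _ [p [q [hp hq q0 ->]]].
    have [p0|p0] := eqVneq p.@[t] 0; last by exists q, p; rewrite invf_div.
    exists 0, 1; rewrite p0 meval0 meval1 oner_eq0 mul0r invr0 mul0r; split => //.
    by apply/mpoly_overP; apply: rpred0.
- exists c%:MP, 1; rewrite mevalC meval1 oner_eq0 divr1; split => //.
  by apply/mpoly_overP; rewrite mpolyOverC; apply/asboolP.
- exists 'X_i, 1; rewrite mevalXU meval1 oner_eq0 divr1; split => //.
  by apply/mpoly_overP; rewrite mpolyOverX.
Qed.

Lemma adj_meval n (t : 'I_n -> F) (f : {mpoly F[n]}) : mpoly_over f -> adj K (codom t) f.@[t].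
Proof.
move=> hf; have sE := adj_subfield K (codom t).
rewrite mevalE; apply: (subfield_sum sE) => m _.
apply: (subfieldM sE); first exact: adj_base.
by apply: (subfield_prod sE) => i _; apply: (subfieldX sE); apply: adj_gen; apply: codom_f.
Qed.

End MPolyOver.

(** * Algebraic independence, one variable at a time *)

Section AlgIndep.
Variables (F : fieldType) (K : F -> Prop) (sK : is_subfield K).

Definition ord_init n (t : 'I_n.+1 -> F) (i : 'I_n) := t (widen_ord (leqnSn n) i).

Lemma codom_ordS n (t : 'I_n.+1 -> F) : codom t = rcons (codom (ord_init t)) (t ord_max).
Proof. by rewrite /codom /image_mem enum_ordSr map_rcons -map_comp. Qed.

Definition ord_ext n (t : 'I_n -> F) a (i : 'I_n.+1) := oapp t a (unlift ord_max i).

Lemma ord_ext_widen n (t : 'I_n -> F) a (i : 'I_n) :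
  ord_ext t a (widen_ord (leqnSn n) i) = t i.
Proof.
have -> : widen_ord (leqnSn n) i = lift ord_max i.
  by apply: val_inj; rewrite /= /bump leqNgt ltn_ord.
by rewrite /ord_ext liftK.
Qed.

Lemma ord_ext_max n (t : 'I_n -> F) a : ord_ext t a ord_max = a.
Proof. by rewrite /ord_ext unlift_none. Qed.

Definition mnm_init n (m : 'X_{1.. n.+1}) : 'X_{1.. n} :=
  [multinom m (widen_ord (leqnSn n) i) | i < n].

Lemma mnm_init_inj n (m m' : 'X_{1.. n.+1}) :
  mnm_init m = mnm_init m' -> m ord_max = m' ord_max -> m = m'.
Proof.
move=> /mnmP h hmax; apply/mnmP => i; case: (unliftP ord_max i) => [j ->|-> //].
have := h j; rewrite !mnmE; have -> // : lift ord_max j = widen_ord (leqnSn n) j.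
by apply: val_inj; rewrite /= /bump leqNgt ltn_ord.
Qed.

(** [muni] reads a polynomial as univariate in its last variable. Locating every coefficient shows
    that nothing cancels in this passage. *)
Lemma coef_muni n (f : {mpoly F[n.+1]}) (m : 'X_{1.. n.+1}) :
  ((muni f)`_(m ord_max))@_(mnm_init m) = f@_m.
Proof.
rewrite muniE coef_sum raddf_sum /=.
rewrite (eq_bigr (fun m2 => f@_m2 * (m2 == m)%:R)) => [|m2 _]; last first.
  rewrite coefZ coefXn mulr_natr mcoeffMn mcoeffZ mcoeffX -/(mnm_init m2).
  rewrite -[LHS]mulr_natr -mulrA -natrM mulnb; congr (_ * (nat_of_bool _)%:R).
  apply/andP/eqP => [[/eqP h1 /eqP h2]|->]; last by rewrite !eqxx.
  exact: mnm_init_inj.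
case: (boolP (m \in msupp f)) => mf.
  rewrite (bigD1_seq m) ?msupp_uniq //= eqxx mulr1 big1 ?addr0 // => m2 /negbTE ->.
  by rewrite mulr0.
rewrite big_seq big1 ?memN_msupp_eq0 // => m2 m2f.
by case: eqP => [e|_]; [rewrite e (negbTE mf) in m2f | rewrite mulr0].
Qed.

Lemma horner_muni n (t : 'I_n.+1 -> F) (f : {mpoly F[n.+1]}) :
  (map_poly (meval (ord_init t)) (muni f)).[t ord_max] = f.@[t].
Proof.
rewrite muniE rmorph_sum horner_sum mevalE; apply: eq_bigr => m _.
rewrite /= map_polyZ map_polyXn hornerZ hornerXn /= mevalZ mevalX -mulrA; congr (_ * _).
by rewrite big_ord_recr /=; congr (_ * _); apply: eq_bigr => i _; rewrite mnmE.
Qed.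

Lemma mpoly_over_muni n (f : {mpoly F[n.+1]}) k : mpoly_over K f -> mpoly_over K (muni f)`_k.
Proof.
move=> hf; rewrite muniE coef_sum; apply/(mpoly_overP sK).
apply: rpred_sum => m _; rewrite coefZ coefXn mulr_natr rpredMn // mpolyOverZ ?mpolyOverX //.
by apply/asboolP; apply: hf.
Qed.

Lemma mwiden_sum n (f : {mpoly F[n]}) :
  mwiden f = \sum_(m <- msupp f) f@_m *: 'X_[mnmwiden m].
Proof.
rewrite {1}[f]mpolyE raddf_sum; apply: eq_bigr => m _.
by rewrite /= mwidenZ mwidenX.
Qed.

Lemma mpoly_over_mwiden n (f : {mpoly F[n]}) : mpoly_over K f -> mpoly_over K (mwiden f).
Proof.
move=> hf; rewrite mwiden_sum; apply/(mpoly_overP sK).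
apply: rpred_sum => m _; rewrite mpolyOverZ ?mpolyOverX //.
by apply/asboolP; apply: hf.
Qed.

Lemma meval_mwiden n (t : 'I_n.+1 -> F) (f : {mpoly F[n]}) : (mwiden f).@[t] = f.@[ord_init t].
Proof.
rewrite mwiden_sum raddf_sum mevalE; apply: eq_bigr => m _.
rewrite /= mevalZ mevalX big_ord_recr /= mnmwiden_ordmax expr0 mulr1; congr (_ * _).
by apply: eq_bigr => i _; rewrite mnmwiden_widen.
Qed.

Lemma muni_mwiden n (f : {mpoly F[n]}) : muni (mwiden f) = f%:P.
Proof.
rewrite mwiden_sum [X in _ = X%:P]mpolyE !raddf_sum; apply: eq_bigr => m _ /=.
rewrite muniZ -mul_polyC -mul_mpolyC polyCM; congr (_ * _).
rewrite muniE msuppX big_seq1 mcoeffX eqxx scale1r mnmwiden_ordmax expr0 alg_polyC.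
by congr (_%:P); congr mpolyX; apply/mnmP => i; rewrite mnmE mnmwiden_widen.
Qed.

Lemma muniX_max n : muni ('X_ord_max : {mpoly F[n.+1]}) = 'X.
Proof.
rewrite muniE msuppX big_seq1 mcoeffX eqxx scale1r mnm1E eqxx expr1.
rewrite (_ : [multinom _ | i < n] = 0%MM) ?mpolyX0 ?scale1r //.
apply/mnmP => i; rewrite mnmE mnm1E mnm0E.
by case: eqP => // /(congr1 val) /= e; have := ltn_ord i; rewrite -e ltnn.
Qed.

(** An equation of the last element has fractions in the other elements as coefficients; multiplied
    by the product of all denominators it becomes a polynomial relation. Conversely, a relation read
    in its last variable is such an equation, nonzero because its coefficients are polynomials in
    independent elements. *)
Lemma alg_indepS n (t : 'I_n.+1 -> F) : alg_indep K t <->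
  alg_indep K (ord_init t) /\ ~ algebraic_over (adj K (codom (ord_init t))) (t ord_max).
Proof.
split=> [ht|[ht nt] f Kf ft].
  have ht' : alg_indep K (ord_init t).
    move=> f Kf f0; apply: (@inj_mwiden n F); rewrite mwiden0; apply: ht.
      exact: mpoly_over_mwiden.
    by rewrite meval_mwiden.
  split => // -[p [p0 Ep pt]].
  have /choice [fg hfg] : forall i, exists fg : {mpoly F[n]} * {mpoly F[n]},
      [/\ mpoly_over K fg.1, mpoly_over K fg.2, fg.2.@[ord_init t] != 0 &
          p`_i = fg.1.@[ord_init t] / fg.2.@[ord_init t]].
    by move=> i; have [f [g h]] := adj_mpoly_frac sK (Ep i); exists (f, g).
  pose h (i : 'I_(size p)) := (fg i).1 * \prod_(j < size p | j != i) (fg j).2.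
  pose D := \prod_(j < size p) (fg j).2.
  have D0 : D.@[ord_init t] != 0.
    by rewrite /D rmorph_prod; apply/prodf_neq0 => j _ /=; case: (hfg j).
  have hE (i : 'I_(size p)) : (h i).@[ord_init t] = p`_i * D.@[ord_init t].
    have [_ _ nz ->] := hfg i.
    have -> : D = (fg i).2 * \prod_(j < size p | j != i) (fg j).2 by rewrite /D (bigD1 i).
    by rewrite /h !mevalM mulrA mulfVK.
  pose P := \sum_(i < size p) mwiden (h i) * 'X_ord_max ^+ i.
  have P0 : P = 0.
    apply: ht => [|].
      apply/(mpoly_overP sK); apply: rpred_sum => i _.
      rewrite rpredM ?rpredX ?mpolyOverX //; apply/mpoly_overP.
      apply: mpoly_over_mwiden; apply/(mpoly_overP sK); rewrite rpredM //.
        by apply/mpoly_overP; case: (hfg i).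
      by apply: rpred_prod => j _; apply/mpoly_overP; case: (hfg j).
    rewrite raddf_sum /=.
    under eq_bigr => i _ do rewrite mevalM rmorphXn /= mevalXU meval_mwiden hE mulrAC.
    by rewrite -mulr_suml -horner_coef (eqP pt) mul0r.
  (* In its last variable [P] has the coefficients [h i]; the leading one does not vanish at
     [ord_init t], contrary to [P0]. *)
  have : muni P = \poly_(i < size p) (if insub i is Some j then h j else 0).
    rewrite poly_def raddf_sum; apply: eq_bigr => i _ /=.
    by rewrite muniM rmorphXn /= muniX_max muni_mwiden valK mul_polyC.
  rewrite P0 muni0 => /polyP/(_ (size p).-1).
  have lt : ((size p).-1 < size p)%N by rewrite prednK // size_poly_gt0.
  rewrite coef0 coef_poly lt insubT /= => /(congr1 (meval (ord_init t))).
  rewrite meval0 hE /= -lead_coefE => /esym/eqP.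
  by rewrite mulf_eq0 lead_coef_eq0 (negbTE p0) (negbTE D0).
apply: contrapT => /eqP; rewrite -msupp_eq0.
case E: (msupp f) => [//|m s] _; case: nt.
have mf : m \in msupp f by rewrite E inE eqxx.
exists (map_poly (meval (ord_init t)) (muni f)); split.
- apply: contraTneq mf => /polyP/(_ (m ord_max)).
  rewrite coef_map coef0 /= => /ht h.
  by rewrite -mcoeff_eq0 -coef_muni h ?mcoeff0 //; apply: mpoly_over_muni.
- by move=> i; rewrite coef_map; apply: adj_meval => //; apply: mpoly_over_muni.
- by rewrite /root horner_muni ft.
Qed.

Lemma alg_indep_chain n (t : 'I_n -> F) : alg_indep K t <-> alg_chain K (rev (codom t)).
Proof.
elim: n t => [|n IH] t.
  rewrite (size0nil (s := codom t)) ?size_codom ?card_ord //=; split => // _ f _.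
  by rewrite [f]nvar0_mpolyC mevalC => ->.
by rewrite alg_indepS codom_ordS rev_rcons /= IH (eq_adj K (mem_rev _)).
Qed.

End AlgIndep.

(** * p-independence *)

Section FrobeniusPowers.
Variables (F : fieldType) (p : nat).
Hypothesis charFp : p \in [pchar F].
Implicit Types (E K M : F -> Prop) (S T : seq F).

Let p_gt1 : (1 < p)%N. Proof. exact/prime_gt1/(pcharf_prime charFp). Qed.
Let p_gt0 : (0 < p)%N. Proof. exact: ltnW. Qed.

Lemma exprp_sum I (r : seq I) (P : pred I) (G : I -> F) :
  (\sum_(i <- r | P i) G i) ^+ p = \sum_(i <- r | P i) G i ^+ p.
Proof.
rewrite -(pFrobenius_autE charFp) rmorph_sum.
by apply: eq_bigr => i _; rewrite /= pFrobenius_autE.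
Qed.

(** There are two fields because adjoining a transcendental [t] to the first adjoins only [t ^+ p]
    to the second. *)
Definition powers_free E E' : Prop := forall (I : finType) (y : I -> F),
  free_fam E y -> free_fam E' (fun i => y i ^+ p).

Lemma separable_powers_free K : is_subfield K -> separable_over K -> powers_free K K.
Proof.
move=> sK hK I y fy.
have fy' : lin_indep K (fun k : 'I_#|I| => y (enum_val k)).
  exact: (free_fam_inj sK enum_val_inj fy).
have := free_fam_inj sK enum_rank_inj (hK _ charFp _ _ fy').
by under eq_fun => i do rewrite enum_rankK.
Qed.

Lemma transcendental_free E t N : is_subfield E -> ~ algebraic_over E t ->
  free_fam E (fun i : 'I_N => t ^+ i).
Proof.
move=> sE nt c Ec h i; apply: contrapT => /eqP ci; case: nt.
exists (\poly_(k < N) (if insub k is Some j then c j else 0)); split.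
- by apply: contraNneq ci => /polyP/(_ i); rewrite coef_poly ltn_ord coef0 valK => ->.
- move=> k; rewrite coef_poly; case: ifP => _; last exact: subfield0.
  by case: insubP => [j _ _|_]; [apply: Ec | apply: subfield0].
- rewrite /root horner_poly -[X in _ == X]h; apply/eqP.
  by apply: eq_bigr => j _; rewrite valK.
Qed.

(** Since [t] is transcendental, the products t^i f_j are free over [E], so the (t^p)^i f_j^p are
    free over [E']. A relation between the f_j^p over E'(t^p) is, up to a denominator, a relation
    between these. *)
Lemma powers_free_adj1 E E' t : is_subfield E -> is_subfield E' ->
  ~ algebraic_over E t -> powers_free E E' -> powers_free (adj E [:: t]) (adj E' [:: t ^+ p]).
Proof.
move=> sE sE' nt hE J f ff c Ec h.
have [P [Q [EP EQ Q0 cP]]] := adj1_common_denom sE' Ec.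
pose N := (\max_j size (P j))%N.
have sEt := adj_subfield E [:: t].
have := hE _ _ (free_fam_tower (@adj_base _ E [:: t]) sEt
  (fun i : 'I_N => subfieldX sEt i (adj_gen (mem_head t [::])))
  (transcendental_free sE nt) ff).
move/(_ (fun k => (P k.2)`_k.1) (fun k => EP k.2 k.1)) => hP.
have P0 j : P j = 0.
  apply/polyP => i; rewrite coef0; case: (ltnP i N) => iN; last first.
    by rewrite nth_default // (leq_trans _ iN) // leq_bigmax.
  apply: (hP _ (Ordinal iN, j)); apply: (mulIf (invr_neq0 Q0)).
  rewrite mul0r -[RHS]h -(pair_bigA _ (fun (i : 'I_N) j => (P j)`_i * (t ^+ i * f j) ^+ p)) /=.
  rewrite exchange_big mulr_suml /=; apply: eq_bigr => k _.
  rewrite cP [(P k).[_]](@horner_coef_wide _ N) ?leq_bigmax // !mulr_suml.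
  by apply: eq_bigr => l _; rewrite exprMn exprAC -!mulrA [_^-1 * _]mulrC.
by move=> j; rewrite cP P0 horner0 mul0r.
Qed.

Lemma powers_free_adj K T : is_subfield K -> separable_over K -> alg_chain K T ->
  powers_free (adj K T) (adj K [seq t ^+ p | t <- T]).
Proof.
move=> sK hK; elim: T => [|t T IH] /=.
  by move=> _; rewrite !adj_nil //; apply: separable_powers_free.
case=> chT nt; rewrite adj_cons [X in powers_free _ X]adj_cons.
by apply: powers_free_adj1 => //; [apply: adj_subfield | apply: adj_subfield | apply: IH].
Qed.

(** As a root of X^p - t^p, each [t] has degree at most [p] over a field that contains t^p. The head
    of [T] moves into the base field, so that the induction hypothesis applies over K(t). *)
Lemma spanned_adj_powers K T (J : finType) (b : J -> F) : is_subfield K ->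
  (forall z, spanned (adj K T) b z) ->
  exists (J' : finType) (b' : J' -> F), #|J'| = (p ^ size T * #|J|)%N /\
    forall z, spanned (adj K [seq t ^+ p | t <- T]) b' z.
Proof.
elim: T K => [|t T IH] K sK sb /=.
  by exists J, b; rewrite expn0 mul1n.
rewrite adj_cons_base in sb.
have [J' [b' [cJ' sb']]] := IH _ (adj_subfield K [:: t]) sb.
exists ('I_p * J')%type, (fun k : 'I_p * J' => t ^+ k.1 * b' k.2).
split; first by rewrite card_prod card_ord cJ' expnS mulnA.
move=> z; apply: (@spanned_tower _ _ _ _ _ (fun i : 'I_p => t ^+ i)) (sb' z) => a.
rewrite -adj_cons_base adj_cons => ha.
set E := adj K (t ^+ p :: _).
have sE : is_subfield E := adj_subfield _ _.
have szp : size ('X^p - (t ^+ p)%:P) = p.+1 by rewrite size_XnsubC.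
have : spanned E (fun i : 'I_(size ('X^p - (t ^+ p)%:P)).-1 => t ^+ i) a.
  apply: adj1_spanned => //.
  - by rewrite -size_poly_gt0 szp.
  - apply: poly_overD => //; first by apply: poly_overXn => //; apply: poly_overX.
    by apply: poly_overN => //; apply: poly_overC => //; apply: adj_gen; rewrite inE eqxx.
  - by rewrite /root !hornerE subrr.
  - apply: adj_subl ha => c; apply: adj_sub => v; rewrite inE orbC => ->.
    by [].
by rewrite szp.
Qed.

Lemma coef_exp_XsubC (a : F) k : (('X - a%:P) ^+ k.+1)`_k = - (k.+1%:R * a).
Proof.
elim: k => [|k IH]; first by rewrite expr1 coefB coefX coefC mul1r sub0r.
rewrite exprS mulrBl coefB coefXM coefCM /= IH.
have -> : (('X - a%:P) ^+ k.+1)`_k.+1 = 1.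
  have /monicP := monic_exp k.+1 (monicXsubC a).
  by rewrite lead_coefE size_exp_XsubC.
by rewrite mulr1 [in RHS]mulrS mulrDl mul1r opprD addrC.
Qed.

(* A common factor over N of a polynomial and of 'X^p - a^p = ('X - a)^p is a
   power ('X - a)^k; for 0 < k < p its subleading coefficient gives back a. *)
Lemma exprp_free (N : F -> Prop) a : is_subfield N -> N (a ^+ p) -> ~ N a ->
  free_fam N (fun i : 'I_p => a ^+ i).
Proof.
move=> sN Nap na c Nc h i; apply: contrapT => /eqP ci; apply: na.
have [L [f fN]] := subfield_fieldType sN.
pose q := \poly_(k < p) (if insub k is Some j then c j else 0).
have q0 : q != 0.
  by apply: contraNneq ci => /polyP/(_ i); rewrite coef_poly ltn_ord coef0 valK => ->.
have Nq : poly_over N q.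
  move=> k; rewrite coef_poly; case: ifP => _; last exact: subfield0.
  by case: insubP => [j _ _|_]; [apply: Nc | apply: subfield0].
have qa : root q a.
  rewrite /root horner_poly -[X in _ == X]h; apply/eqP.
  by apply: eq_bigr => j _; rewrite valK.
have szq : (size q <= p)%N := size_poly _ _.
have [q' eq] := poly_over_lift fN (rmorph0 f) Nq.
have /fN [b eb] := Nap.
have er : map_poly f ('X^p - b%:P) = ('X - a%:P) ^+ p.
  rewrite rmorphB /= map_polyXn map_polyC /= -eb.
  have charP : p \in [pchar {poly F}] by rewrite pchar_poly.
  by rewrite -[RHS](pFrobenius_autE charP) rmorphB /= !pFrobenius_autE -polyC_exp.
pose g := gcdp q' ('X^p - b%:P).
have ga : root (map_poly f g) a.
  by rewrite gcdp_map root_gcd -eq qa er rootE horner_exp !hornerE subrr expr0n gtn_eqF.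
have : map_poly f g %| ('X - a%:P) ^+ p by rewrite -er dvdp_map dvdp_gcdr.
case/dvdp_exp_XsubCP => k _ gk.
have eg : map_poly f g = lead_coef (map_poly f g) *: ('X - a%:P) ^+ k.
  have := eqp_eq gk; rewrite (monicP (monic_exp _ (monicXsubC a))).
  by rewrite scale1r.
have q'0 : q' != 0 by apply: contraNneq q0 => e; rewrite eq e rmorph0.
have ltkp : (k < p)%N.
  have := eqp_size gk; rewrite size_exp_XsubC => <-.
  by rewrite size_map_poly (leq_trans (dvdp_leq q'0 (dvdp_gcdl _ _))) // -(size_map_poly f) -eq.
case: k gk eg ltkp => [|k] gk eg ltkp.
  by move: gk; rewrite expr0 => /eqp_root/(_ a); rewrite ga (negbTE (root1 a)).
have Ng j : N (map_poly f g)`_j by apply/fN; exists g`_j; rewrite coef_map.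
have := Ng k; rewrite eg coefZ coef_exp_XsubC => Nk.
have l0 : lead_coef (map_poly f g) != 0.
  rewrite lead_coef_eq0 map_poly_eq0 gcdp_eq0 negb_and q'0 //.
have k0 : k.+1%:R != 0 :> F.
  by rewrite -(dvdn_pcharf charFp) gtnNdvd.
have -> : a = - (lead_coef (map_poly f g))^-1 *
    (lead_coef (map_poly f g) * - (k.+1%:R * a)) / k.+1%:R.
  by rewrite mulrN mulrNN mulKf // mulrAC mulfV // mul1r.
apply: (subfield_div sN); last exact: subfield_nat.
apply: (subfieldM sN) => //; apply: (subfieldN sN); apply: (subfieldV sN).
exact: Ng.
Qed.

Definition pth_powers : F -> Prop := fun z => exists w, z = w ^+ p.

(** For [M] containing F^p this is p-independence over [M]: every entry, the newest at the head,
    multiplies the degree by [p]. *)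
Fixpoint p_chain M S : Prop := if S is a :: S' then p_chain M S' /\ ~ adj M S' a else True.

(** The family consists of the monomials in [S] with exponents below [p]. [exprp_free] deals with
    each new entry, because its p-th power lies in [M]. *)
Lemma p_chain_free M S : is_subfield M -> (forall z, M (z ^+ p)) -> p_chain M S ->
  exists (J : finType) (e : J -> F),
    [/\ #|J| = (p ^ size S)%N, free_fam M e & forall j, adj M S (e j)].
Proof.
move=> sM Mp; elim: S => [|a S IH] /=.
  move=> _; exists unit, (fun=> 1); split; first by rewrite card_unit.
    by move=> c _ h []; rewrite -[RHS]h (bigD1 tt) //= big1 ?addr0 ?mulr1 // => -[].
  by move=> _; apply: subfield1; apply: adj_subfield.
case=> /IH [J [e [cJ fe Se]]] na.
exists (J * 'I_p)%type, (fun k : J * 'I_p => e k.1 * a ^+ k.2); split.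
- by rewrite card_prod card_ord cJ expnSr.
- apply: (@free_fam_tower _ M (adj M S) _ _ e (fun i : 'I_p => a ^+ i)) => //.
  + by move=> z; apply: adj_base.
  + exact: adj_subfield.
  apply: exprp_free => //; first exact: adj_subfield.
  by apply: adj_base.
- move=> k; have s := adj_subfield M (a :: S); apply: (subfieldM s).
    by apply: adj_sub (Se k.1) => v; rewrite inE orbC => ->.
  by apply: (subfieldX s); apply: adj_gen; rewrite inE eqxx.
Qed.

(* Compare dimensions over K(T^p): with d = [F : K(T)], F is spanned by d p^#|T|
   elements, while F has d p^#|S| free ones, obtained by a tower through
   M = K F^p, which contains d free elements by separability. *)
Lemma p_chain_leq K S T : is_subfield K -> separable_over K -> fin_generated K ->
  alg_chain K T -> (forall z, algebraic_over (adj K T) z) ->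
  p_chain (adjoin K pth_powers) S -> (size S <= size T)%N.
Proof.
move=> sK hK fK chT hT chS.
have sE := adj_subfield K T.
have [J [b sb]] := fin_generated_finite fK hT.
have [I [f [I0 ff sf]]] := exists_basis sE sb.
have [J' [b' [cJ' sb']]] := spanned_adj_powers sK sf.
pose M := adjoin K pth_powers.
have sM : is_subfield M := adjoin_subfield _ _.
have Mp z : M (z ^+ p) by apply: adjoin_gen; exists z.
have [L [e [cL fe _]]] := p_chain_free sM Mp chS.
have KM : forall a, adj K [seq t ^+ p | t <- T] a -> M a.
  apply: adj_min => // a; first exact: adjoin_base.
  by case/mapP => t _ ->.
have := free_fam_leq (adj_subfield _ _)
  (free_fam_tower KM sM (fun i => Mp (f i)) (powers_free_adj sK hK chT ff) fe)
  (fun i => sb' _).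
by rewrite card_prod cL cJ' mulnC leq_pmul2r // leq_exp2l.
Qed.

(** The span of the y_i^p contains [E] and F^p and is closed under products, since a product of two
    such powers is the p-th power of a combination of the y_i. Being also closed under inverses, it
    is a field and hence all of [F]. *)
Lemma spanned_exprp E (I : finType) (y : I -> F) : is_subfield E ->
  (forall z, spanned E y z) -> (forall z, adjoin E pth_powers z) ->
  forall z, spanned E (fun i => y i ^+ p) z.
Proof.
move=> sE sy hE z; pose G := spanned E (fun i => y i ^+ p).
have Gp w : G (w ^+ p).
  have [c Ec ->] := sy w; exists (fun i => c i ^+ p) => [i|]; first exact: subfieldX.
  by rewrite exprp_sum; apply: eq_bigr => i _; rewrite exprMn.
have GM a b : G a -> G b -> G (a * b).
  move=> [c Ec ->] [d Ed ->]; rewrite mulr_suml; apply: spanned_sum => // i _.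
  rewrite mulr_sumr; apply: spanned_sum => // j _.
  rewrite mulrACA -exprMn; apply: spannedZ; [by [] | exact: subfieldM | exact: Gp].
have G1 : G 1 by rewrite -(expr1n F p); apply: Gp.
have sG : is_subfield G.
  split=> // [a b Ga Gb|a Ga].
    apply: spannedD => //; rewrite -mulN1r; apply: spannedZ => //.
    by apply: (subfieldN sE); apply: subfield1.
  have [->|a0] := eqVneq a 0; first by rewrite invr0; apply: spanned0.
  have GX k : G (a ^+ k) by elim: k => [|k IH]; rewrite ?expr0 // exprS; apply: GM.
  (* Both factors lie in [G], although the inverse itself is not yet known to. *)
  have -> : a^-1 = a ^+ p.-1 * a^-1 ^+ p.
    by rewrite -{2}(prednK p_gt0) exprSr mulrA -exprMn divff // expr1n mul1r.
  exact: GM.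
apply: hE => // a; last by case=> w ->; apply: Gp.
by move=> Ea; rewrite -[a]mulr1; apply: spannedZ.
Qed.

(** A free family is enlarged to a basis. The p-th powers of a basis span [F], hence are free by
    counting, and so are those of the part started from. *)
Lemma powers_free_of_generated E (J : finType) (b : J -> F) : is_subfield E ->
  (forall z, spanned E b z) -> (forall z, adjoin E pth_powers z) -> powers_free E E.
Proof.
move=> sE sb hE.
suff: forall k (I : finType) (y : I -> F), (#|J| < #|I| + k)%N -> free_fam E y ->
    free_fam E (fun i => y i ^+ p).
  by move=> h I y; apply: (h #|J|.+1); rewrite addnS ltnS leq_addl.
elim=> [|k IH] I y lt fy.
  by move: lt; rewrite addn0 ltnNge (free_fam_leq sE fy (fun i => sb (y i))).
case: (EM (forall z, spanned E y z)) => [sy|/existsNP [z nz]].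
  by apply: (free_fam_of_spanning sE fy) => // i; apply: spanned_exprp.
have := IH _ _ _ (free_fam_extend sE fy nz); rewrite card_option addSnnS => /(_ lt).
by apply: (free_fam_inj (h := @Some I) sE) => u v [].
Qed.

End FrobeniusPowers.

(** * Separating transcendence bases *)

Section SeparatingBases.
Variables (F : fieldType) (K : F -> Prop).
Hypotheses (sK : is_subfield K) (hK : separable_over K) (fK : fin_generated K).
Implicit Types (S T : seq F).

Lemma codom_nth n S : size S = n -> codom (fun i : 'I_n => nth 0 S i) = S.
Proof.
move=> sS; rewrite /codom /image_mem (map_comp (nth 0 S) val) val_enum_ord.
by rewrite map_nth_iota0 ?sS // -sS take_size.
Qed.

Lemma trbasis_alg_indep n (t w : 'I_n -> F) : trbasis K t -> alg_indep K w -> trbasis K w.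
Proof.
move=> [/(alg_indep_chain sK) cht ht] aw; split=> // z.
rewrite adjoin_frange -(eq_adj K (mem_rev _)); apply: (alg_chain_max (T := codom t)).
- exact/(alg_indep_chain sK).
- by move=> a; rewrite -adjoin_frange.
- by rewrite size_rev !size_codom.
Qed.

Lemma separable_adj T : (forall z, algebraic_over (adj K T) z) ->
  (forall p, p \in [pchar F] -> forall z, adj (adjoin K (@pth_powers F p)) T z) ->
  separable_over (adj K T).
Proof.
move=> hT gT p charFp n y fy; have [J [b sb]] := fin_generated_finite fK hT.
apply: (powers_free_of_generated charFp (adj_subfield K T) sb) fy => z.
have s := adjoin_subfield (adj K T) (@pth_powers F p).
move: (gT p charFp z); apply: adj_min => // a; last first.
  by move=> aT; apply: adjoin_base; apply: adj_gen.
by apply => // c hc; [apply: adjoin_base; apply: adj_base | apply: adjoin_gen].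
Qed.

Section PChains.
Variables (p : nat) (charFp : p \in [pchar F]).
Let M := adjoin K (@pth_powers F p).
Let sM : is_subfield M := adjoin_subfield _ _.

(** An element outside would lengthen the chain beyond the bound of [p_chain_leq]. *)
Lemma p_chain_full n (t : 'I_n -> F) S : trbasis K t -> size S = n -> p_chain M S ->
  forall z, adj M S z.
Proof.
move=> [/(alg_indep_chain sK) cht ht] sS chS z; apply: contrapT => nz.
have := @p_chain_leq _ _ charFp K (z :: S) _ sK hK fK cht _ (conj chS nz).
rewrite size_rev size_codom card_ord /= sS ltnn => h.
by have : false by apply: h => a; rewrite (eq_adj K (mem_rev _)) -adjoin_frange.
Qed.

(** An entry outside the field generated by the later ones is kept; one inside is moved by z u^p
    with [z] outside, and since u^p lies in [M] the sum is outside too. Once no such [z] exists, the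
    second alternative holds and further entries stay as they are. [P] abstracts closeness, so that
    no valuation appears here. *)
Lemma perturb_p_chain (P : F -> F -> Prop) : (forall w, P w w) ->
  (forall w z, exists2 u, u != 0 & P w (w + z * u ^+ p)) ->
  forall S, exists S', [/\ size S' = size S, forall i, P (nth 0 S i) (nth 0 S' i) &
    p_chain M S' \/ forall z, adj M S' z].
Proof.
move=> Pww hP; elim=> [|a S [S' [sS' PS' chS']]].
  by exists [::]; split => //; left.
case: (EM (forall z, adj M S' z)) => [full|/existsNP [z nz]].
  exists (a :: S'); split; rewrite /= ?sS' //; first by case.
  by right=> z; apply: adj_sub (full z) => v; rewrite inE orbC => ->.
have {}chS' : p_chain M S' by case: chS' => // /(_ z).
have s := adj_subfield M S'.
case: (EM (adj M S' a)) => ha; last first.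
  by exists (a :: S'); split; rewrite /= ?sS' //; [case | left].
have [u u0 Pu] := hP a z; exists (a + z * u ^+ p :: S').
split; rewrite /= ?sS' //; first by case.
left; split=> // h; apply: nz.
have uM : adj M S' (u ^+ p) by apply: adj_base; apply: adjoin_gen; exists u.
have -> : z = (a + z * u ^+ p - a) / u ^+ p.
  by rewrite addrAC subrr add0r mulfK // expf_neq0.
by apply: (subfield_div s) => //; apply: (subfieldB s).
Qed.

(* A field is not the union of two proper subgroups, so that one element can be
   chosen both transcendental and p-independent over the previous ones. *)
Lemma exists_chain n (t : 'I_n -> F) k : trbasis K t -> (k <= n)%N ->
  exists T, [/\ size T = k, alg_chain K T & p_chain M T \/ forall z, adj M T z].
Proof.
move=> [/(alg_indep_chain sK) cht ht]; elim: k => [|k IH] lekn.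
  by exists [::]; split => //; left.
have [T [sT chT pT]] := IH (ltnW lekn).
have sE := adj_subfield K T; have sMT := adj_subfield M T.
have [a na] : exists a, ~ algebraic_over (adj K T) a.
  apply/existsNP => hT; have := alg_chain_leq cht (fun a _ => hT a).
  by rewrite size_rev size_codom card_ord sT leqNgt lekn.
case: (EM (forall z, adj M T z)) => [full|/existsNP [b nb]].
  exists (a :: T); split; rewrite /= ?sT //.
  by right=> z; apply: adj_sub (full z) => v; rewrite inE orbC => ->.
have {}pT : p_chain M T by case: pT => // /(_ b).
suff [c [nc mc]] : exists c, ~ algebraic_over (adj K T) c /\ ~ adj M T c.
  by exists (c :: T); split; rewrite /= ?sT //; left.
case: (EM (adj M T a)) => ma; last by exists a.
case: (EM (algebraic_over (adj K T) b)) => ab; last by exists b.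
exists (a + b); split => [h|h]; last first.
  by apply: nb; have := subfieldB sMT h ma; rewrite addrAC subrr add0r.
apply: na; have s := adj_subfield (adj K T) [:: a + b; b].
apply: (algebraic_adj (S := [:: a + b; b]) sE).
  by move=> v; rewrite !inE => /orP [/eqP -> | /eqP ->].
have : adj (adj K T) [:: a + b; b] (a + b - b).
  by apply: (subfieldB s); apply: adj_gen; rewrite !inE eqxx ?orbT.
by rewrite addrK.
Qed.

End PChains.

(** A chain of length [n] generates [F] over K F^p, either by its construction or by [p_chain_full];
    in characteristic 0 there is nothing to arrange. *)
Lemma exists_separating_trbasis n (t : 'I_n -> F) : trbasis K t ->
  exists w : 'I_n -> F, trbasis K w /\ separable_over (adjoin K (frange w)).
Proof.
move=> ht; case: (EM (exists p, p \in [pchar F])) => [[p charFp]|char0]; last first.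
  by exists t; split => // p charFp; case: char0; exists p.
have [T [sT chT pT]] := exists_chain p ht (leqnn n).
have cT : codom (fun i : 'I_n => nth 0 (rev T) i) = rev T by apply: codom_nth; rewrite size_rev.
have aT z : algebraic_over (adj K T) z.
  case: ht => _ ht'; apply: (alg_chain_max (T := codom t)) => //.
    by move=> a; rewrite -adjoin_frange.
  by rewrite size_codom card_ord.
exists (fun i => nth 0 (rev T) i); rewrite adjoin_frange cT (eq_adj K (mem_rev T)); split.
  by apply: (trbasis_alg_indep ht); apply/(alg_indep_chain sK); rewrite cT revK.
apply: separable_adj => // p' charFp'.
rewrite (pcharf_eq charFp) in charFp'; move/eqP: charFp' => ->.
by case: pT => // h; apply: (p_chain_full charFp ht).
Qed.

(** What the perturbation argument asks of closeness: it is reflexive, it allows some z u^p to be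
    added to any element, and it keeps [w] algebraically independent. *)
Lemma perturb_separating n (t w : 'I_n -> F) (P : F -> F -> Prop) : trbasis K t ->
  (forall a, P a a) ->
  (forall p a z, p \in [pchar F] -> exists2 u, u != 0 & P a (a + z * u ^+ p)) ->
  (forall w' : 'I_n -> F, (forall i, P (w i) (w' i)) -> alg_indep K w') ->
  exists w' : 'I_n -> F,
    [/\ forall i, P (w i) (w' i), trbasis K w' & separable_over (adjoin K (frange w'))].
Proof.
move=> ht Paa hP hw; case: (EM (exists p, p \in [pchar F])) => [[p charFp]|char0]; last first.
  exists w; split => //; first by apply: (trbasis_alg_indep ht); apply: hw.
  by move=> p charFp; case: char0; exists p.
have [S' [sS' PS' pS']] := perturb_p_chain Paa (fun a z => hP p a z charFp) (codom w).
rewrite size_codom card_ord in sS'.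
have cS : codom (fun i : 'I_n => nth 0 S' i) = S' by apply: codom_nth.
have Pw i : P (w i) (nth 0 S' i).
  by have := PS' i; rewrite (nth_map i) ?size_enum_ord // nth_ord_enum.
have tw := trbasis_alg_indep ht (hw _ Pw).
exists (fun i => nth 0 S' i); split => //.
rewrite adjoin_frange cS; apply: separable_adj => [z|p' charFp'].
  by case: tw => _ /(_ z); rewrite adjoin_frange cS.
rewrite (pcharf_eq charFp) in charFp'; move/eqP: charFp' => ->.
by case: pS' => // h; apply: (p_chain_full charFp ht).
Qed.

End SeparatingBases.

(** * Valuations *)

Section ValuationRing.
Variables (F : fieldType) (O : F -> Prop) (vO : is_valring O).
Local Notation vmax := (vmax O).
Local Notation vunit := (vunit O).

Lemma valring1 : O 1. Proof. by case: vO. Qed.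

Lemma valringB a b : O a -> O b -> O (a - b).
Proof. by case: vO => _ h _ _; apply: h. Qed.

Lemma valring0 : O 0.
Proof. by rewrite -(subrr 1); apply: valringB; apply: valring1. Qed.

Lemma valringN a : O a -> O (- a).
Proof. by rewrite -[- a]add0r => Oa; apply: valringB => //; apply: valring0. Qed.

Lemma valringD a b : O a -> O b -> O (a + b).
Proof. by move=> Oa Ob; rewrite -[b]opprK; apply: valringB => //; apply: valringN. Qed.

Lemma valringM a b : O a -> O b -> O (a * b).
Proof. by case: vO => _ _ h _; apply: h. Qed.

Lemma valringX a n : O a -> O (a ^+ n).
Proof.
move=> Oa; elim: n => [|n IH]; first by rewrite expr0; apply: valring1.
by rewrite exprS; apply: valringM.
Qed.

Lemma valring_sum I (r : seq I) (P : pred I) (G : I -> F) :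
  (forall i, P i -> O (G i)) -> O (\sum_(i <- r | P i) G i).
Proof. by move=> h; apply: big_ind => //; [apply: valring0 | apply: valringD]. Qed.

Lemma valring_prod I (r : seq I) (P : pred I) (G : I -> F) :
  (forall i, P i -> O (G i)) -> O (\prod_(i <- r | P i) G i).
Proof. by move=> h; apply: big_ind => //; [apply: valring1 | apply: valringM]. Qed.

Lemma valring_total a b : a != 0 -> b != 0 -> O (a / b) \/ O (b / a).
Proof.
case: vO => _ _ _ h a0 b0.
by have := h (a / b) (mulf_neq0 a0 (invr_neq0 b0)); rewrite invf_div.
Qed.

Lemma vmax_valring a : vmax a -> O a. Proof. by case. Qed.

Lemma vmax0 : vmax 0. Proof. by split; [apply: valring0 | left]. Qed.

Lemma vmaxM a b : O a -> vmax b -> vmax (a * b).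
Proof.
move=> Oa [Ob mb]; split; first exact: valringM.
have [ab0|ab0] := eqVneq (a * b) 0; first by left.
right => Oab; case: mb => [b0|]; first by rewrite b0 mulr0 eqxx in ab0.
apply; have [a0|a0] := eqVneq a 0; first by rewrite a0 mul0r eqxx in ab0.
have -> : b^-1 = a * (a * b)^-1 by rewrite invfM mulrA divff ?mul1r.
exact: valringM.
Qed.

Lemma vmaxMr a b : vmax a -> O b -> vmax (a * b).
Proof. by move=> ma Ob; rewrite mulrC; apply: vmaxM. Qed.

Lemma vmax_inv a : a != 0 -> ~ O a -> vmax a^-1.
Proof.
move=> a0 na; split; last by right; rewrite invrK.
by case: vO => _ _ _ h; case: (h a a0).
Qed.

Lemma vmaxP a : vmax a <-> O a /\ ~ vunit a.
Proof.
split=> [[Oa ma]|[Oa na]]; split=> //.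
  by case=> a0 _ Oai; case: ma => // /eqP; rewrite (negbTE a0).
have [->|a0] := eqVneq a 0; first by left.
by right => Oai; apply: na.
Qed.

Lemma vunit_vmax a : vunit a -> ~ vmax a.
Proof. by move=> ua /vmaxP []. Qed.

Lemma not_vmax a : O a -> ~ vmax a -> vunit a.
Proof. by move=> Oa na; apply: contrapT => nu; apply: na; apply/vmaxP. Qed.

Lemma vmaxN a : vmax a -> vmax (- a).
Proof. by move=> ma; rewrite -mulN1r; apply: vmaxM => //; apply/valringN/valring1. Qed.

Lemma vmaxD a b : vmax a -> vmax b -> vmax (a + b).
Proof.
move=> ma mb; have [->|a0] := eqVneq a 0; first by rewrite add0r.
have [->|b0] := eqVneq b 0; first by rewrite addr0.
have [h|h] := valring_total a0 b0.
  have -> : a + b = (a / b + 1) * b by rewrite mulrDl mul1r divfK.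
  by apply: vmaxM => //; apply: valringD => //; apply: valring1.
have -> : a + b = (1 + b / a) * a by rewrite mulrDl mul1r divfK.
by apply: vmaxM => //; apply: valringD => //; apply: valring1.
Qed.

Lemma vmaxB a b : vmax a -> vmax b -> vmax (a - b).
Proof. by move=> ma mb; apply: vmaxD => //; apply: vmaxN. Qed.

Lemma vmax_sum I (r : seq I) (P : pred I) (G : I -> F) :
  (forall i, P i -> vmax (G i)) -> vmax (\sum_(i <- r | P i) G i).
Proof. by move=> h; apply: big_ind => //; [apply: vmax0 | apply: vmaxD]. Qed.

Lemma vunit_valring a : vunit a -> O a. Proof. by case. Qed.

Lemma vunit1 : vunit 1.
Proof. by split; rewrite ?invr1 ?oner_eq0 //; apply: valring1. Qed.

Lemma vunitV a : vunit a -> vunit a^-1.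
Proof. by case=> a0 Oa Oai; split; rewrite ?invr_eq0 ?invrK. Qed.

Lemma vunitM a b : vunit a -> vunit b -> vunit (a * b).
Proof.
case=> a0 Oa Oai [b0 Ob Obi]; split; rewrite ?mulf_neq0 ?invfM //; exact: valringM.
Qed.

Lemma vunit_div a b : vunit a -> vunit b -> vunit (a / b).
Proof. by move=> ua ub; apply: vunitM => //; apply: vunitV. Qed.

Lemma vunit_exprz a (n : int) : vunit a -> vunit (a ^ n).
Proof.
move=> ua; have uX k : vunit (a ^+ k).
  by elim: k => [|k IH]; rewrite ?expr0 ?exprS; [apply: vunit1 | apply: vunitM].
by case: n => n; [apply: uX | apply: vunitV; apply: uX].
Qed.

Lemma vunit_prod I (r : seq I) (P : pred I) (G : I -> F) :
  (forall i, P i -> vunit (G i)) -> vunit (\prod_(i <- r | P i) G i).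
Proof. by move=> h; apply: big_ind => //; [apply: vunit1 | apply: vunitM]. Qed.

Lemma vunit_vmaxD a b : vunit a -> vmax (b - a) -> vunit b.
Proof.
move=> ua mab; have -> : b = a + (b - a) by rewrite addrC subrK.
apply: not_vmax; first by apply: valringD; [case: ua | case: mab].
move=> h; apply: (vunit_vmax ua); rewrite -[a](addrK (b - a)); exact: vmaxB.
Qed.

(** [O (a i / a i0)] says that the value of [a i0] is at most that of [a i]. *)
Lemma exists_vmin (T : eqType) (s : seq T) (a : T -> F) : s != [::] ->
  (forall i, i \in s -> a i != 0) ->
  exists2 i0, i0 \in s & forall i, i \in s -> O (a i / a i0).
Proof.
elim: s => [//|i [|j s] IH] _ h.
  exists i; first by rewrite inE.
  by move=> k; rewrite inE => /eqP ->; rewrite divff ?h ?inE //; apply: valring1.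
have [//| k ks|i0 i0s hi0] := IH; first by apply: h; rewrite inE ks orbT.
have ai : a i != 0 by rewrite h ?inE ?eqxx.
have ai0 : a i0 != 0 by rewrite h // inE i0s orbT.
have [hi|hi] := valring_total ai ai0.
  exists i0; first by rewrite inE i0s orbT.
  by move=> k; rewrite inE => /orP [/eqP ->|/hi0].
exists i; first by rewrite inE eqxx.
move=> k; rewrite inE => /orP [/eqP ->|/hi0 h0].
  by rewrite divff //; apply: valring1.
have -> : a k / a i = a k / a i0 * (a i0 / a i) by rewrite mulrA divfK.
exact: valringM.
Qed.

Lemma vmax_congM a a' b b' : O a -> O b' -> vmax (a' - a) -> vmax (b' - b) ->
  vmax (a' * b' - a * b).
Proof.
move=> Oa Ob' ma mb.
have -> : a' * b' - a * b = (a' - a) * b' + a * (b' - b).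
  by rewrite mulrBl mulrBr addrA subrK.
by apply: vmaxD; [apply: vmaxMr | apply: vmaxM].
Qed.

Lemma vmax_congX a a' n : O a -> O a' -> vmax (a' - a) -> vmax (a' ^+ n - a ^+ n).
Proof.
move=> Oa Oa' h; elim: n => [|n IH]; first by rewrite !expr0 subrr; apply: vmax0.
by rewrite !exprS; apply: vmax_congM => //; apply: valringX.
Qed.

Lemma vmax_cong_prod I (r : seq I) (a a' : I -> F) : (forall i, O (a i)) ->
  (forall i, O (a' i)) -> (forall i, vmax (a' i - a i)) ->
  vmax (\prod_(i <- r) a' i - \prod_(i <- r) a i).
Proof.
move=> Oa Oa' h; elim: r => [|i r IH]; first by rewrite !big_nil subrr; apply: vmax0.
by rewrite !big_cons; apply: vmax_congM => //; apply: valring_prod.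
Qed.

Lemma vmax_cong_meval n (y y' : 'I_n -> F) (f : {mpoly F[n]}) : (forall m, O f@_m) ->
  (forall i, O (y i)) -> (forall i, O (y' i)) -> (forall i, vmax (y' i - y i)) ->
  vmax (f.@[y'] - f.@[y]).
Proof.
move=> Of Oy Oy' h; rewrite !mevalE -sumrB; apply: vmax_sum => m _.
rewrite -mulrBr; apply: vmaxM => //; apply: vmax_cong_prod => i; try exact: valringX.
exact: vmax_congX.
Qed.

Lemma valring_meval n (y : 'I_n -> F) (f : {mpoly F[n]}) : (forall m, O f@_m) ->
  (forall i, O (y i)) -> O f.@[y].
Proof.
move=> Of Oy; rewrite mevalE; apply: valring_sum => m _; apply: valringM => //.
by apply: valring_prod => i _; apply: valringX.
Qed.

End ValuationRing.

(** * Elements with independent values or residues, and their perturbation *)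

Section ValuationIndependence.
Variables (F : fieldType) (K O : F -> Prop).
Hypotheses (sK : is_subfield K) (vO : is_valring O).
Local Notation vmax := (vmax O).
Local Notation vunit := (vunit O).

Lemma in_vK_mulK c z : K c -> c != 0 -> in_vK K O (c * z) -> in_vK K O z.
Proof.
move=> Kc c0 [d [Kd d0 u]]; exists (d / c); split; first exact: subfield_div.
  by rewrite mulf_neq0 ?invr_eq0.
by rewrite invf_div mulrCA mulrA.
Qed.

Lemma in_vK_unit z : vunit z -> in_vK K O z.
Proof. by exists 1; split; rewrite ?divr1 ?oner_eq0 //; apply: subfield1. Qed.

Section ValuationIndependentFamily.
Variables (r s : nat) (x : 'I_r -> F) (y : 'I_s -> F).
Hypotheses (x0 : forall i, x i != 0) (hx : vindep K O x).
Hypotheses (Oy : forall i, O (y i)) (hy : res_alg_indep K O y).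
Let t := catf x y.

Lemma catf_lshift i : t (lshift s i) = x i.
Proof. by rewrite /t /catf -[lshift s i]/(unsplit (inl i)) unsplitK. Qed.

Lemma catf_rshift i : t (rshift r i) = y i.
Proof. by rewrite /t /catf -[rshift r i]/(unsplit (inr i)) unsplitK. Qed.

Definition lmnm (m : 'X_{1.. r + s}) : 'X_{1.. r} := [multinom m (lshift s i) | i < r].
Definition rmnm (m : 'X_{1.. r + s}) : 'X_{1.. s} := [multinom m (rshift r i) | i < s].

Lemma lrmnm_inj m m' : lmnm m = lmnm m' -> rmnm m = rmnm m' -> m = m'.
Proof.
move=> /mnmP hl /mnmP hr; apply/mnmP => k; rewrite -(splitK k).
by case: (split k) => i /=; [have := hl i | have := hr i]; rewrite !mnmE.
Qed.

Definition xmon (m : 'X_{1.. r}) : F := \prod_i x i ^+ m i.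

Lemma xmon_neq0 m : xmon m != 0.
Proof. by apply/prodf_neq0 => i _; rewrite expf_neq0. Qed.

Lemma xmon_div m m' : xmon m / xmon m' = \prod_i x i ^ ((m i)%:Z - (m' i)%:Z).
Proof.
rewrite /xmon -prodf_div; apply: eq_bigr => i _.
by rewrite expfzDr // -invr_expz.
Qed.

Lemma xmon_indep c m m' : K c -> c != 0 -> vunit (c * (xmon m / xmon m')) -> m = m'.
Proof.
move=> Kc c0 /in_vK_unit /(in_vK_mulK Kc c0); rewrite xmon_div => /hx h.
by apply/mnmP => i; apply/eqP; rewrite -eqz_nat -subr_eq0 h.
Qed.

(* The term of least value singles out the exponent e of x; the terms with the
   same exponent add up to g(y), and all others have larger value. *)
Lemma leading_form (f : {mpoly F[r + s]}) : f != 0 -> mpoly_over K f ->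
  exists c e (g : {mpoly F[s]}),
    [/\ K c, c != 0, (forall m, K g@_m /\ O g@_m), vunit g.@[y] &
        vmax (f.@[t] / (c * xmon e) - g.@[y])].
Proof.
move=> f0 Kf.
have [||m0 m0f hm0] := @exists_vmin _ _ vO _ (msupp f) (fun m => f@_m * xmon (lmnm m)).
- by rewrite msupp_eq0.
- by move=> m mf; rewrite mulf_neq0 ?xmon_neq0 // -mcoeff_msupp.
have c0 : f@_m0 != 0 by rewrite -mcoeff_msupp.
have q0 := xmon_neq0 (lmnm m0).
pose g := \sum_(m <- msupp f | lmnm m == lmnm m0) (f@_m / f@_m0) *: 'X_[rmnm m].
have Og m : K g@_m /\ O g@_m.
  rewrite /g big_seq_cond !raddf_sum /=; split.
    apply: subfield_sum => // m1 _; rewrite mcoeffZ mcoeffX.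
    by apply: subfieldM => //; [apply: subfield_div | apply: subfield_nat].
  apply: valring_sum => // m1 /andP [m1f /eqP em]; rewrite mcoeffZ mcoeffX.
  have := hm0 _ m1f; rewrite em -mulf_div divff // mulr1 => Oc.
  by case: eqP => _; rewrite ?mulr1 ?mulr0 //; apply: valring0.
(* Division by the minimal term leaves a coefficient 1, so the reduction of [g] is nonzero and [hy]
   makes g(y) a unit. *)
have g1 : g@_(rmnm m0) = 1.
  rewrite /g -big_filter raddf_sum (bigD1_seq m0) /=; last 2 first.
  - by rewrite mem_filter eqxx.
  - by rewrite filter_uniq ?msupp_uniq.
  rewrite mcoeffZ mcoeffX eqxx divff // mulr1 big_seq_cond big1 ?addr0 // => m1.
  rewrite mem_filter -andbA => /and3P [/eqP el _ nm]; rewrite mcoeffZ mcoeffX.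
  case: eqP => [er|_]; last by rewrite mulr0.
  by rewrite (lrmnm_inj el er) eqxx in nm.
exists f@_m0, (lmnm m0), g; split => //.
  apply: not_vmax; first by apply: valring_meval => // m; case: (Og m).
  apply: hy => //; exists (rmnm m0); rewrite g1.
  exact/vunit_vmax/vunit1.
have -> : f.@[t] / (f@_m0 * xmon (lmnm m0)) =
    \sum_(m <- msupp f) f@_m * xmon (lmnm m) / (f@_m0 * xmon (lmnm m0)) *
      \prod_i y i ^+ rmnm m i.
  rewrite mevalE mulr_suml; apply: eq_bigr => m _.
  rewrite big_split_ord /= mulrA mulrAC; congr (_ * _ / _ * _).
    by apply: eq_bigr => i _; rewrite catf_lshift mnmE.
  by apply: eq_bigr => i _; rewrite catf_rshift mnmE.
rewrite (bigID (fun m => lmnm m == lmnm m0)) /= addrAC.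
have -> : g.@[y] = \sum_(m <- msupp f | lmnm m == lmnm m0)
     f@_m * xmon (lmnm m) / (f@_m0 * xmon (lmnm m0)) * \prod_i y i ^+ rmnm m i.
  rewrite /g raddf_sum; apply: eq_bigr => m /eqP -> /=.
  by rewrite mevalZ mevalX -mulf_div divff // mulr1.
rewrite subrr add0r big_seq_cond; apply: vmax_sum => // m /andP [mf nm].
apply: vmaxMr => //; last by apply: valring_prod => // i _; apply: valringX.
apply/vmaxP => //; split; first exact: hm0.
rewrite -mulf_div => /xmon_indep h; case/eqP: nm; apply: h; first exact: subfield_div.
by rewrite mulf_neq0 ?invr_eq0 // -mcoeff_msupp.
Qed.

(** At a zero of [f] the leading form would give g(y) positive value, although it is a unit. *)
Lemma vindep_alg_indep : alg_indep K t.
Proof.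
move=> f Kf ft; apply: contrapT => /eqP /leading_form /(_ Kf) [c [e [g [_ _ _ ug]]]].
by rewrite ft mul0r sub0r => /(vmaxN vO); rewrite opprK; apply: vunit_vmax.
Qed.

Let KT := adjoin K (frange t).

(** The quotient of two leading forms. Here [u] and [v] are units with the residues of g(y) and
    h(y), so the value of [z] can be read off from [c], [e], [e'], and its residue, if these
    contribute a unit, from [g] and [h]. *)
Lemma adj_leading_form z : KT z -> z != 0 ->
  exists c e e' u v (g h : {mpoly F[s]}),
    [/\ K c /\ c != 0, (forall m, K g@_m /\ O g@_m) /\ (forall m, K h@_m /\ O h@_m),
        vunit g.@[y] /\ vunit h.@[y], vmax (u - g.@[y]) /\ vmax (v - h.@[y]) &
        z = c * (xmon e / xmon e') * (u / v)].
Proof.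
rewrite /KT adjoin_frange => /(adj_mpoly_frac sK) [f [f' [Kf Kf' f't ->]]] z0.
have ft : f.@[t] != 0 by apply: contraNneq z0 => ->; rewrite mul0r.
have f0 : f != 0 by apply: contraNneq ft => ->; rewrite meval0.
have f'0 : f' != 0 by apply: contraNneq f't => ->; rewrite meval0.
have [c [e [g [Kc c0 Og ug mg]]]] := leading_form f0 Kf.
have [c' [e' [g' [Kc' c'0 Og' ug' mg']]]] := leading_form f'0 Kf'.
exists (c / c'), e, e', (f.@[t] / (c * xmon e)), (f'.@[t] / (c' * xmon e')), g, g'.
split => //; first by split; [apply: subfield_div | rewrite mulf_neq0 ?invr_eq0].
have X0 := xmon_neq0 e; have X0' := xmon_neq0 e'.
by field; rewrite c0 c'0 X0 X0' f't.
Qed.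

Lemma vindep_vgroup_sum : vgroup_sum K KT O x.
Proof.
split=> // z Kz z0.
have [c [e [e' [u [v [g [h [[Kc c0] _ [ug uh] [mu mv] zE]]]]]]]] := adj_leading_form Kz z0.
exists (fun i => (e i)%:Z - (e' i)%:Z); rewrite -xmon_div zE.
have q0 : xmon e / xmon e' != 0 by rewrite mulf_neq0 ?invr_eq0 ?xmon_neq0.
exists c; split=> //.
have -> : c * (xmon e / xmon e') * (u / v) / (xmon e / xmon e') / c = u / v.
  have [v0 _ _] := vunit_vmaxD vO uh mv.
  by field; rewrite v0 c0 !xmon_neq0.
by apply: vunit_div; [exact: vO | apply: vunit_vmaxD ug mu | apply: vunit_vmaxD uh mv].
Qed.

Lemma res_alg_indep_resfield_gen : resfield_gen K KT O y.
Proof.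
split=> //; split; last first.
  move=> f g hf hg ug; exists (f.@[y] / g.@[y]); rewrite subrr; split; last exact: vmax0.
    have s1 : is_subfield KT := adjoin_subfield _ _.
    have yKT i : KT (y i) by apply: adjoin_gen; exists (rshift r i); rewrite catf_rshift.
    suff hm (p : {mpoly F[s]}) : (forall m, K p@_m /\ O p@_m) -> KT p.@[y].
      by apply: (subfield_div s1); apply: hm.
    move=> hp; rewrite mevalE; apply: (subfield_sum s1) => m _; apply: (subfieldM s1).
      by apply: adjoin_base; case: (hp m).
    by apply: (subfield_prod s1) => i _; apply: (subfieldX s1).
  apply: valringM => //; last by case: ug.
  by apply: valring_meval => // m; case: (hf m).
move=> z Kz Oz; case: (EM (vmax z)) => [mz|nz].
  exists 0, 1; rewrite meval0 meval1 mul0r subr0; split => //.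
  - by move=> m; rewrite mcoeff0; split; [apply: subfield0 | apply: valring0].
  - move=> m; rewrite mcoeff1; case: eqP => _ /=.
      by split; [apply: subfield1 | apply: valring1].
    by split; [apply: subfield0 | apply: valring0].
  - exact: vunit1.
have uz := not_vmax Oz nz.
have z0 : z != 0 by case: uz.
have [c [e [e' [u [v [g [h [[Kc c0] [Og Oh] [ug uh] [mu mv] zE]]]]]]]] := adj_leading_form Kz z0.
have uu := vunit_vmaxD vO ug mu; have uv := vunit_vmaxD vO uh mv.
have uuv : vunit (u / v) by apply: vunit_div.
have uc : vunit (c * (xmon e / xmon e')).
  have -> : c * (xmon e / xmon e') = z / (u / v).
    by rewrite zE [RHS]mulfK //; case: uuv.
  exact: vunit_div.
(* A unit [z] leaves no value for c x^(e - e'); independence of the values of [x] then makes this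
   factor an element of [K]. *)
have ee := xmon_indep Kc c0 uc.
rewrite ee divff ?xmon_neq0 // mulr1 in uc zE.
have Oc := vunit_valring uc.
exists (c *: g), h; split => //.
  move=> m; rewrite mcoeffZ; case: (Og m) => Kg Ogm.
  by split; [apply: subfieldM | apply: valringM].
have [[v0 _ Ovi] [h0 _ Ohi]] := (uv, uh).
rewrite zE mevalZ -mulrA -mulrBr; apply: vmaxM => //.
have Og' : O g.@[y] by case: ug.
have Oh' : O h.@[y] by case: uh.
have -> : u / v - g.@[y] / h.@[y] = (u * h.@[y] - g.@[y] * v) / (v * h.@[y]).
  by rewrite -mulNr addf_div // mulNr.
apply: vmaxMr => //; last by rewrite invfM; apply: valringM.
apply: vmax_congM => //.
by rewrite -opprB; apply: vmaxN.
Qed.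

End ValuationIndependentFamily.

(** The first condition preserves residues, as needed for the [y i], the second preserves values, as
    needed for the [x i]; one relation thus serves the whole list. For [w = 0] the second holds
    trivially, division by 0 giving 0. *)
Definition vclose (w w' : F) : Prop := vmax (w' - w) /\ vmax ((w' - w) / w).

Lemma vclose_refl w : vclose w w.
Proof. by split; rewrite subrr ?mul0r; apply: vmax0. Qed.

Lemma vclose_vunit w w' : w != 0 -> vclose w w' -> vunit (w' / w).
Proof.
move=> w0 [_ h]; apply: (vunit_vmaxD vO (vunit1 vO)).
by move: h; rewrite mulrBl divff.
Qed.

Lemma vclose_neq0 w w' : w != 0 -> vclose w w' -> w' != 0.
Proof.
by move=> w0 /(vclose_vunit w0) [+ _ _]; apply: contraNneq => ->; rewrite mul0r.
Qed.

Lemma vclose_vindep r (x x' : 'I_r -> F) : (forall i, x i != 0) ->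
  (forall i, vclose (x i) (x' i)) -> vindep K O x -> vindep K O x'.
Proof.
move=> x0 hc hx m [c [Kc c0 u]]; apply: hx; exists c; split => //.
have uq : vunit (\prod_i (x' i / x i) ^ m i).
  by apply: vunit_prod => // i _; apply: vunit_exprz => //; apply: vclose_vunit.
have -> : \prod_i x i ^ m i = \prod_i x' i ^ m i / \prod_i (x' i / x i) ^ m i.
  rewrite -prodf_div; apply: eq_bigr => i _.
  rewrite expfzMl exprz_inv -invr_expz invf_div [RHS]mulrC divfK //.
  exact: expfz_neq0 (vclose_neq0 (x0 i) (hc i)).
by rewrite mulrAC; apply: vunit_div.
Qed.

Lemma cong_res_alg_indep s (y y' : 'I_s -> F) : (forall i, O (y i)) ->
  (forall i, O (y' i)) -> (forall i, vmax (y' i - y i)) ->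
  res_alg_indep K O y -> res_alg_indep K O y'.
Proof.
move=> Oy Oy' h hy f Of nf mf; apply: (hy f Of nf).
have := vmax_cong_meval vO (fun m => proj2 (Of m)) Oy Oy' h.
by move=> /(vmaxB vO mf); rewrite opprB addrCA subrr addr0.
Qed.

(** One factor of [u] makes the perturbation small, the other makes it small relative to [a]; both
    lie in [O], so neither spoils the effect of the other. *)
Lemma vclose_perturb w0 (p : nat) (a z : F) : w0 != 0 -> vmax w0 -> (0 < p)%N ->
  exists2 u, u != 0 & vclose a (a + z * u ^+ p).
Proof.
move=> w00 mw0 p0.
have small w : exists u, [/\ u != 0, O u & vmax (w * u ^+ p)].
  have Ow0 := vmax_valring mw0.
  case: (EM (O w)) => Ow.
    exists w0; split => //; apply: vmaxM => //.
    by rewrite -(prednK p0) exprS; apply: vmaxMr => //; apply: valringX.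
  have wn0 : w != 0 by apply: contra_notN Ow => /eqP ->; apply: valring0.
  have mw := vmax_inv vO wn0 Ow; have Owi := vmax_valring mw.
  (* The choice gives w (w0/w)^p = w0 (w0/w)^(p-1), and the last factor lies in [O]. *)
  exists (w0 / w); split; first by rewrite mulf_neq0 ?invr_eq0.
    exact: valringM.
  have -> : w * (w0 / w) ^+ p = w0 * (w0 ^+ p.-1 * w^-1 ^+ p.-1).
    by rewrite -{1}(prednK p0) exprS exprMn mulrA [w * (w0 / w)]mulrCA divff // mulr1.
  by apply: vmaxMr => //; apply: valringM => //; apply: valringX.
have [u [u0 Ou mu]] := small z; have [v [v0 Ov mv]] := small (z / a).
exists (u * v); first by rewrite mulf_neq0.
rewrite /vclose addrAC subrr add0r exprMn; split.
  by rewrite mulrA; apply: vmaxMr => //; apply: valringX.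
by rewrite mulrAC mulrCA mulrC; apply: vmaxMr => //; apply: valringX.
Qed.

End ValuationIndependence.

(** * Bases of the value group *)

Section ValueGroup.
Variables (F : fieldType) (K O : F -> Prop).
Hypotheses (sK : is_subfield K) (vO : is_valring O).
Local Notation vmax := (vmax O).
Local Notation vunit := (vunit O).

(** The nonzero terms of a relation have pairwise different values, already modulo vE. Dividing by
    the term of least value would write 1 as a sum of elements of positive value. *)
Lemma distinct_values_free E (I : finType) (z : I -> F) : is_subfield E ->
  (forall i, z i != 0) -> (forall i j, i != j -> ~ in_vK E O (z i / z j)) -> free_fam E z.
Proof.
move=> sE z0 hz c Ec h; apply: contrapT => /existsNP [i1 /eqP ci1].
pose s := [seq i <- enum I | c i != 0].
have i1s : i1 \in s by rewrite mem_filter ci1 mem_enum.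
have [||i0] := @exists_vmin _ _ vO _ s (fun i => c i * z i).
- by case: (s) i1s.
- by move=> i; rewrite mem_filter => /andP [ci _]; rewrite mulf_neq0.
rewrite mem_filter => /andP [c0 _] hi0.
have q0 : c i0 * z i0 != 0 by rewrite mulf_neq0.
apply: (vunit_vmax (vunit1 vO)).
have -> : 1 = - \sum_(i | i != i0) c i * z i / (c i0 * z i0).
  apply: (mulIf q0); rewrite mul1r mulNr -mulr_suml divfK //.
  by apply/eqP; rewrite -addr_eq0 -[X in _ == X]h [X in _ == X](bigD1 i0).
apply: vmaxN => //; apply: vmax_sum => // i ni.
have [ci|ci] := eqVneq (c i) 0; first by rewrite ci !mul0r; apply: vmax0.
apply/vmaxP; split; first by apply: hi0; rewrite mem_filter ci mem_enum.
move=> u; apply: (hz _ _ ni); exists (c i0 / c i); split.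
- exact: subfield_div.
- by rewrite mulf_neq0 ?invr_eq0.
- suff -> : z i / z i0 / (c i0 / c i) = c i * z i / (c i0 * z i0) by [].
  by field; rewrite c0 ci z0.
Qed.

Lemma in_vK1 : in_vK K O 1.
Proof. by apply: in_vK_unit => //; apply: vunit1. Qed.

Lemma in_vKM a b : in_vK K O a -> in_vK K O b -> in_vK K O (a * b).
Proof.
move=> [c [Kc c0 uc]] [d [Kd d0 ud]]; exists (c * d).
by split; [apply: subfieldM | rewrite mulf_neq0 | rewrite -mulf_div; apply: vunitM].
Qed.

Lemma in_vKV a : in_vK K O a -> in_vK K O a^-1.
Proof.
move=> [c [Kc c0 uc]]; exists c^-1; split; [exact: subfieldV | by rewrite invr_eq0 |].
by rewrite -invfM; apply: vunitV.
Qed.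

Lemma in_vK_div a b : in_vK K O a -> in_vK K O b -> in_vK K O (a / b).
Proof. by move=> ha hb; apply: in_vKM => //; apply: in_vKV. Qed.

Lemma in_vK_exprz a (n : int) : in_vK K O a -> in_vK K O (a ^ n).
Proof.
move=> ha; have hX k : in_vK K O (a ^+ k).
  by elim: k => [|k IH]; rewrite ?expr0 ?exprS; [apply: in_vK1 | apply: in_vKM].
by case: n => n; [apply: hX | apply: in_vKV; apply: hX].
Qed.

Section Lattice.
Variable r : nat.
Implicit Types (x : 'I_r -> F) (m : 'I_r -> int).

Definition zmon x m : F := \prod_i x i ^ m i.

(** Membership of v(z) in the subgroup of vF generated by vK and the v(x_i). *)
Definition vspan x (z : F) : Prop := exists m, in_vK K O (z / zmon x m).

Variable x : 'I_r -> F.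
Hypothesis x0 : forall i, x i != 0.

Lemma zmon_neq0 m : zmon x m != 0.
Proof. by apply/prodf_neq0 => i _; apply: expfz_neq0. Qed.

Lemma zmonD m m' : zmon x (fun i => m i + m' i) = zmon x m * zmon x m'.
Proof. by rewrite /zmon -big_split; apply: eq_bigr => i _; rewrite expfzDr. Qed.

Lemma zmonM m (k : int) : zmon x (fun i => m i * k) = zmon x m ^ k.
Proof.
rewrite /zmon (big_morph (fun a => a ^ k) (id1 := 1) (op1 := *%R)) ?exp1rz //.
  by apply: eq_bigr => i _; rewrite exprz_exp.
by move=> a b; rewrite expfzMl.
Qed.

Lemma vspan_in_vK z : in_vK K O z -> vspan x z.
Proof.
by move=> h; exists (fun=> 0); rewrite /zmon big1 ?divr1 // => i _; rewrite expr0z.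
Qed.

Lemma vspan_memb i : vspan x (x i).
Proof.
exists (fun j => (j == i)%:Z); rewrite /zmon (bigD1 i) //= eqxx expr1z big1 ?mulr1.
  by rewrite divff //; apply: in_vK1.
by move=> j /negbTE ->; rewrite expr0z.
Qed.

Lemma vspanM a b : vspan x a -> vspan x b -> vspan x (a * b).
Proof.
move=> [m ha] [m' hb]; exists (fun i => m i + m' i).
by rewrite zmonD -mulf_div; apply: in_vKM.
Qed.

Lemma vspan_exprz a (k : int) : vspan x a -> vspan x (a ^ k).
Proof.
move=> [m ha]; exists (fun i => m i * k); rewrite zmonM.
have -> : a ^ k / zmon x m ^ k = (a / zmon x m) ^ k.
  by rewrite expfzMl exprz_inv invr_expz.
exact: in_vK_exprz.
Qed.

Lemma vspan_div a b : vspan x a -> vspan x b -> vspan x (a / b).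
Proof. by move=> ha /(vspan_exprz (-1)); rewrite -[b ^ _]/(b ^-1); apply: vspanM. Qed.

Lemma vspan_prod I (s : seq I) (P : pred I) (G : I -> F) :
  (forall i, P i -> vspan x (G i)) -> vspan x (\prod_(i <- s | P i) G i).
Proof.
by move=> h; apply: big_ind => //; [apply/vspan_in_vK/in_vK1 | apply: vspanM].
Qed.

End Lattice.

Lemma vspan_sub r (x x' : 'I_r -> F) : (forall i, x i != 0) -> (forall i, x' i != 0) ->
  (forall i, vspan x' (x i)) -> forall z, vspan x z -> vspan x' z.
Proof.
move=> x0 x'0 h z [m hm]; rewrite -[z](divfK (zmon_neq0 x0 m)).
apply: vspanM => //; first exact: vspan_in_vK.
by apply: vspan_prod => // i _; apply: vspan_exprz.
Qed.

Hypothesis hfree : forall z, z != 0 -> forall n, (0 < n)%N ->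
  in_vK K O (z ^+ n) -> in_vK K O z.

Section Enlarge.
Variables (r : nat) (x : 'I_r -> F).
Hypotheses (x0 : forall i, x i != 0) (hx : vindep K O x).
Hypothesis hr : forall b : 'I_r.+1 -> F, (forall i, b i != 0) -> ~ vindep K O b.

(** The rank forces a relation between [x] and [z] modulo vK, and it must involve [z] because the
    [x i] are independent. *)
Lemma vspan_torsion z : z != 0 -> exists2 n : nat, (0 < n)%N & vspan x (z ^+ n).
Proof.
move=> z0; pose b := ord_ext x z.
have b0 i : b i != 0 by rewrite /b /ord_ext; case: unlift => /=.
have /existsNP [m /not_implyP [hm /existsNP [i /eqP mi]]] := hr b0.
rewrite big_ord_recr /= /b ord_ext_max in hm.
pose m' (i : 'I_r) := m (widen_ord (leqnSn r) i).
have {}hm : in_vK K O (zmon x m' * z ^ m ord_max).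
  by move: hm; under eq_bigr => j _ do rewrite ord_ext_widen.
have hz : vspan x (z ^ m ord_max).
  exists (fun i => m' i * (-1)); rewrite zmonM.
  by rewrite -[_ ^ (-1)]/(_ ^-1) invrK mulrC.
have [mz|mz] := eqVneq (m ord_max) 0; last first.
  exists `|m ord_max|%N; first by rewrite absz_gt0.
  have [e|e] : (`|m ord_max|%:Z = m ord_max) \/ (`|m ord_max|%:Z = m ord_max * (-1)).
    by case: (m ord_max) => n; [left | right; rewrite NegzE mulrN1 opprK].
    by rewrite exprnP e.
  by rewrite exprnP e -exprz_exp; apply: vspan_exprz.
rewrite mz expr0z mulr1 in hm; have {}hm := hx hm.
case/eqP: mi; case: (unliftP ord_max i) => [j ->|->] //.
have -> : lift ord_max j = widen_ord (leqnSn r) j; last exact: hm.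
by apply: val_inj; rewrite /= /bump leqNgt ltn_ord.
Qed.

(** If [n] is the order of [z] modulo the span and [p] divides [n], then z^(n/p) has order [p]. *)
Lemma vspan_prime_torsion : (exists2 z, z != 0 & ~ vspan x z) ->
  exists p z, [/\ prime p, z != 0, ~ vspan x z & vspan x (z ^+ p)].
Proof.
case=> z z0 nz.
have ex : exists n, (0 < n)%N && `[< vspan x (z ^+ n) >].
  by have [n n0 hn] := vspan_torsion z0; exists n; rewrite n0; apply/asboolP.
case: (ex_minnP ex) => n /andP [n0 /asboolP hn] nmin.
have n1 : (1 < n)%N.
  rewrite ltn_neqAle n0 andbT; apply/eqP => e; apply: nz.
  by rewrite -[z]expr1 e.
have pp := pdiv_prime n1; have /dvdnP [q nq] := pdiv_dvd n.
exists (pdiv n), (z ^+ q); split => //; first by rewrite expf_neq0.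
  move=> hq; have q0 : (0 < q)%N by move: n0; rewrite nq muln_gt0 => /andP [].
  have := nmin q; rewrite q0 (introT (asboolP _) hq) => /(_ isT).
  by rewrite nq leqNgt ltn_Pmulr // prime_gt1.
by rewrite -exprM -nq.
Qed.

(* If v(z^p) = sum_j m_j v(x_j) mod vK with p prime to m_i, then z' = z^u x_i^(-q),
   where u m_i = 1 + q p, can replace x_i. *)
Lemma vspan_enlarge : (exists2 z, z != 0 & ~ vspan x z) ->
  exists (x' : 'I_r -> F) z, [/\ forall i, x' i != 0, vindep K O x',
    forall a, vspan x a -> vspan x' a,
    z != 0 /\ ~ vspan x z & vspan x' z].
Proof.
move/vspan_prime_torsion => [p [z [pp z0 nz [m hm]]]].
(* If [p] divided every [m i], the p-th power of z / prod_i x_i^(m_i/p) would have its value in vK;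
   torsion-freeness would then put [z] into the span. *)
have [i ni] : exists i, ~~ (p %| `|m i|)%N.
  apply: contrapT => /forallNP h; apply: nz.
  have dvd i : (p %| m i)%Z by rewrite dvdzE; apply: contrapT => /negP; apply: h.
  exists (fun i => (m i %/ p)%Z); apply: (hfree (n := p) _ (prime_gt0 pp)).
  - by rewrite mulf_neq0 ?invr_eq0 ?zmon_neq0.
  - suff -> : (z / zmon x (fun i => (m i %/ p)%Z)) ^+ p = z ^+ p / zmon x m by [].
    rewrite exprMn exprVn; congr (_ / _); rewrite exprnP -zmonM.
    by apply: eq_bigr => j _; rewrite divzK.
have [u [q e]] : exists u q : int, u * m i = 1 + q * p%:Z.
  have : coprimez (m i) p by rewrite coprimezE coprime_sym prime_coprime.
  case/coprimezP => -[u q] /= e; exists u, (- q); rewrite mulNr; apply/eqP.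
  by rewrite eq_sym subr_eq eq_sym e.
pose z' := z ^ u / x i ^ q.
have z'0 : z' != 0 by rewrite mulf_neq0 ?invr_eq0 ?expfz_neq0.
pose x' j := if j == i then z' else x j.
have x'0 j : x' j != 0 by rewrite /x'; case: ifP.
(* The coordinates of v(z'^p) in terms of the v(x_j). The one at [i] is u m_i - q p = 1, so x_i can
   be recovered from z'^p and the other x_j. *)
pose d j : int := m j * u - (j == i)%:Z * (q * p%:Z).
have di : d i = 1 by rewrite /d eqxx mul1r mulrC e addrK.
have hd : in_vK K O (z' ^+ p / zmon x d).
  suff -> : z' ^+ p / zmon x d = (z ^+ p / zmon x m) ^ u by apply: in_vK_exprz.
  have -> : zmon x d = zmon x m ^ u / x i ^ (q * p%:Z).
    rewrite -zmonM /d (zmonD x0 (fun j => m j * u)); congr (_ * _).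
    rewrite /zmon (bigD1 i) //= eqxx mul1r big1 ?mulr1 ?invr_expz // => j /negbTE ->.
    by rewrite mul0r oppr0 expr0z.
  have -> : z' ^+ p = (z ^+ p) ^ u / x i ^ (q * p%:Z).
    by rewrite /z' expr_div_n !exprnP !exprz_exp [u * _]mulrC.
  rewrite expfzMl exprz_inv -invr_expz.
  by field; rewrite !expfz_neq0 // zmon_neq0.
have memb j : j != i -> vspan x' (x j).
  by move=> /negbTE nj; have := vspan_memb x'0 j; rewrite /x' nj.
have membz : vspan x' z' by have := vspan_memb x'0 i; rewrite /x' eqxx.
have dE : zmon x d = x i * \prod_(j | j != i) x j ^ d j.
  by rewrite /zmon (bigD1 i) //= di expr1z.
have P0 : \prod_(j | j != i) x j ^ d j != 0.
  by apply/prodf_neq0 => j _; rewrite expfz_neq0.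
have membi : vspan x' (x i).
  have -> : x i = z' ^+ p / (z' ^+ p / zmon x d) / \prod_(j | j != i) x j ^ d j.
    rewrite dE; move: (z' ^+ p) (expf_neq0 p z'0) (x0 i) => a a0.
    by move: (x i) (\prod_(j | _) _) P0 => c d' d'0 c0; field; rewrite c0 d'0 a0.
  apply: vspan_div => //; last by apply: vspan_prod => // j /memb; apply: vspan_exprz.
  by apply: vspan_div => //; [rewrite exprnP; apply: vspan_exprz | apply: vspan_in_vK].
exists x', z'; split => //.
- move=> n hn.
  (* A relation [n] between the [x' j], multiplied by [p], is a relation between the [x j] with
     coefficient n_i at [i] and d_j n_i + p n_j elsewhere. So n_i = 0, and then every n_j = 0. *)
  have {}hn : in_vK K O (zmon x (fun j => d j * n i + (if j == i then 0 else n j * p%:Z))).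
    rewrite zmonD // zmonM.
    have -> : zmon x (fun j => if j == i then 0 else n j * p%:Z) =
        (zmon x' n / z' ^ n i) ^ p.
      rewrite /zmon (bigD1 i) //= eqxx expr0z mul1r [in RHS](bigD1 i) //= {1}/x' eqxx.
      rewrite mulrAC divff ?expfz_neq0 // mul1r.
      rewrite (big_morph (fun a => a ^ p) (id1 := 1) (op1 := *%R)) ?exp1rz //.
        by apply: eq_bigr => j /negbTE nj; rewrite nj /x' nj exprz_exp.
      by move=> a b; rewrite expfzMl.
    have -> : zmon x d ^ n i * (zmon x' n / z' ^ n i) ^ p =
        zmon x' n ^ p / (z' ^+ p / zmon x d) ^ n i.
      have eA : (z' ^+ p) ^ n i = (z' ^ n i) ^ p by rewrite exprnP !exprz_exp mulrC.
      rewrite [(zmon x' n / _) ^ p]expfzMl [(_ / zmon x d) ^ _]expfzMl !exprz_inv -!invr_expz.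
      by rewrite eA invf_div mulrCA.
    by apply: in_vK_div; apply: in_vK_exprz.
  have := hx hn => {}hn.
  have ni0 : n i = 0 by have := hn i; rewrite eqxx di mul1r addr0.
  move=> j; have [->//|nj] := eqVneq j i.
  have := hn j; rewrite (negbTE nj) ni0 mulr0 add0r => /eqP.
  by rewrite mulf_eq0 eqz_nat eqn0Ngt prime_gt0 // orbF => /eqP.
- apply: vspan_sub => // j; have [->//|nj] := eqVneq j i; exact: memb.
- split=> // hz'; apply: nz.
  have hu : vspan x (z ^ u).
    have -> : z ^ u = z' * x i ^ q by rewrite /z' divfK ?expfz_neq0.
    by apply: vspanM => //; apply: vspan_exprz => //; apply: vspan_memb.
  have hp : vspan x (z ^ p) by exists m.
  (* As u m_i - q p = 1, the element [z] is recovered from z^u and z^p, which would both be in the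
     span. *)
  have -> : z = (z ^ u) ^ m i / (z ^ p) ^ q.
    by rewrite !exprz_exp e mulrC invr_expz mulrC -expfzDr // [p%:Z * q]mulrC addrK expr1z.
  by apply: vspan_div => //; apply: vspan_exprz.
Qed.

End Enlarge.

(* Each enlargement of vspan x' adds an element with a new class modulo vE, and
   there are at most [F : E] such classes. *)
Lemma exists_value_basis r (x : 'I_r -> F) E (J : finType) (b : J -> F) :
  (forall i, x i != 0) -> vindep K O x ->
  (forall b : 'I_r.+1 -> F, (forall i, b i != 0) -> ~ vindep K O b) ->
  is_subfield E -> (forall z, spanned E b z) -> (forall z, E z -> z != 0 -> vspan x z) ->
  exists x' : 'I_r -> F, [/\ forall i, x' i != 0, vindep K O x' &
    forall z, z != 0 -> vspan x' z].
Proof.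
move=> x0 hx hr sE sb Ex.
suff: forall k (I : finType) (g : I -> F) (x' : 'I_r -> F), (#|J| < #|I| + k)%N ->
    (forall i, x' i != 0) -> vindep K O x' -> (forall z, vspan x z -> vspan x' z) ->
    (forall i, g i != 0 /\ vspan x' (g i)) ->
    (forall i j, i != j -> ~ in_vK E O (g i / g j)) ->
    exists x' : 'I_r -> F, [/\ forall i, x' i != 0, vindep K O x' &
      forall z, z != 0 -> vspan x' z].
  by move/(_ #|J|.+1 void (fun=> 1) x); apply => //; rewrite card_void.
elim=> [|k IH] I g x' lt x'0 hx' xx' hg ng.
  have := free_fam_leq sE (distinct_values_free sE (fun i => proj1 (hg i)) ng) (fun i => sb (g i)).
  by rewrite leqNgt -[#|I|]addn0 lt.
case: (EM (exists2 z, z != 0 & ~ vspan x' z)) => [|full]; last first.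
  exists x'; split => // z z0; apply: contrapT => nz; apply: full; by exists z.
move/(vspan_enlarge x'0 hx' hr) => [x2 [z [x20 hx2 x2x [z0 nz] hz]]].
have nE w : in_vK E O w -> vspan x' w.
  move=> [c [Ec c0 u]]; rewrite -[w](divfK c0); apply: vspanM => //.
    by apply: vspan_in_vK; apply: in_vK_unit.
  by apply: xx'; apply: Ex.
apply: (IH (option I) (oapp g z) x2) => //.
- by rewrite card_option addSnnS.
- by move=> w /xx'; apply: x2x.
- by case=> [i|] //=; case: (hg i) => gi /x2x.
have inv w : in_vK E O w -> in_vK E O w^-1.
  move=> [c [Ec c0 u]]; exists c^-1; split; [exact: subfieldV | by rewrite invr_eq0 |].
  by rewrite -invfM; apply: vunitV.
have nzg i : ~ in_vK E O (z / g i).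
  move=> /nE h; apply: nz; have [gi hgi] := hg i.
  by rewrite -[z](divfK gi); apply: vspanM.
case=> [i|] [j|] //=; first exact: ng.
by move=> _ /inv; rewrite invf_div; apply: nzg.
Qed.

End ValueGroup.

(** * The residue field *)

Section ResidueField.
Variables (F : fieldType) (O : F -> Prop).
Local Notation vmax := (vmax O).

Definition vrep (a : F) : F := choose [pred b | `[< vmax (a - b) >]] a.

Definition resb & is_valring O : {pred F} := [pred a | `[< O a /\ vrep a = a >]].

Variable vO : is_valring O.

Lemma vrepP a : vmax (a - vrep a).
Proof.
apply/asboolP; apply: (@chooseP _ [pred b | `[< vmax (a - b) >]] a).
by apply/asboolP; rewrite subrr; apply: vmax0.
Qed.

(** [choose] depends on the predicate only, not on the witness, and congruent elements define the
    same predicate. *)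
Lemma eq_vrep a b : vmax (a - b) -> vrep a = vrep b.
Proof.
move=> ab; rewrite /vrep (@choose_id _ [pred c | `[< vmax (a - c) >]] a b).
- apply: eq_choose => c /=; apply/asboolP/asboolP => h.
    by have := vmaxB vO h ab; rewrite opprB addrC addrA subrK.
  by have := vmaxD vO ab h; rewrite addrA subrK.
- by apply/asboolP; rewrite subrr; apply: vmax0.
- exact/asboolP.
Qed.

Lemma vrep_valring a : O a -> O (vrep a).
Proof.
move=> Oa; have -> : vrep a = a - (a - vrep a) by rewrite opprB addrC subrK.
by apply: valringB => //; case: (vrepP a).
Qed.

Definition vclass a := if `[< O a >] then vrep a else vrep 0.

Fact vclassP a : vclass a \in resb vO.
Proof.
have h b : O b -> vrep b \in resb vO.
  by move=> Ob; apply/asboolP; split; [apply: vrep_valring | rewrite -(eq_vrep (vrepP b))].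
by rewrite /vclass; case: asboolP => Oa; apply: h => //; apply: valring0.
Qed.

(* The residue field is realized on canonical representatives of the classes
   modulo the maximal ideal; resid sends everything outside O to 0. *)
Inductive residue_sort := ResidueElt a & a \in resb vO.
Definition residue_val u := let: ResidueElt a _ := u in a.

HB.instance Definition _ := [isSub for residue_val].
HB.instance Definition _ := [Choice of residue_sort by <:].

Local Notation R := residue_sort.

Definition resid a : R := ResidueElt (vclassP a).

Lemma residue_valring (u : R) : O (val u).
Proof. by case: u => a /= /asboolP []. Qed.

Lemma residue_valK (u : R) : resid (val u) = u.
Proof.
apply: val_inj; rewrite /= /vclass; case: u => a /= /asboolP [Oa ra].
by case: asboolP.
Qed.

Lemma val_resid a : O a -> vmax (a - val (resid a)).
Proof. by move=> Oa; rewrite /= /vclass; case: asboolP => // _; apply: vrepP. Qed.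

Lemma eq_resid a b : O a -> O b -> (resid a = resid b <-> vmax (a - b)).
Proof.
move=> Oa Ob; split=> [e|ab]; last first.
  apply: val_inj; rewrite /= /vclass; case: asboolP => //; case: asboolP => // _ _.
  exact: eq_vrep.
have := vmaxB vO (val_resid Oa) (val_resid Ob).
by rewrite e opprB addrA subrK.
Qed.

Definition residue_add (u v : R) := resid (val u + val v).
Definition residue_opp (u : R) := resid (- val u).
Definition residue_mul (u v : R) := resid (val u * val v).
Definition residue_inv (u : R) := resid (val u)^-1.

Lemma resid_add a b : O a -> O b -> residue_add (resid a) (resid b) = resid (a + b).
Proof.
move=> Oa Ob; have [Oa' Ob'] := (residue_valring (resid a), residue_valring (resid b)).
apply/eq_resid; try exact: valringD.
rewrite opprD addrACA.
by apply: vmaxD => //; rewrite -opprB; apply: vmaxN => //; apply: val_resid.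
Qed.

Lemma resid_opp a : O a -> residue_opp (resid a) = resid (- a).
Proof.
move=> Oa; have Oa' := residue_valring (resid a).
apply/eq_resid; try exact: valringN.
by rewrite opprK addrC; apply: val_resid.
Qed.

Lemma resid_mul a b : O a -> O b -> residue_mul (resid a) (resid b) = resid (a * b).
Proof.
move=> Oa Ob; have [Oa' Ob'] := (residue_valring (resid a), residue_valring (resid b)).
apply/eq_resid; try exact: valringM.
by apply: vmax_congM => //; rewrite -opprB; apply: vmaxN => //; apply: val_resid.
Qed.

Lemma residP (u : R) : exists2 a, O a & u = resid a.
Proof. by exists (val u); [apply: residue_valring | rewrite residue_valK]. Qed.

Fact residue_addA : associative residue_add.
Proof.
move=> u v w; have [[a Oa ->] [b Ob ->] [c Oc ->]] := And3 (residP u) (residP v) (residP w).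
by rewrite !resid_add ?addrA //; apply: valringD.
Qed.

Fact residue_addC : commutative residue_add.
Proof. by move=> u v; rewrite /residue_add addrC. Qed.

Fact residue_add0 : left_id (resid 0) residue_add.
Proof.
move=> u; have [a Oa ->] := residP u; rewrite resid_add ?add0r //; exact: valring0.
Qed.

Fact residue_addN : left_inverse (resid 0) residue_opp residue_add.
Proof.
move=> u; have [a Oa ->] := residP u; rewrite resid_opp // resid_add ?addNr //.
exact: valringN.
Qed.

HB.instance Definition _ := GRing.isZmodule.Build R
  residue_addA residue_addC residue_add0 residue_addN.

Fact residue_mulA : associative residue_mul.
Proof.
move=> u v w; have [[a Oa ->] [b Ob ->] [c Oc ->]] := And3 (residP u) (residP v) (residP w).
by rewrite !resid_mul ?mulrA //; apply: valringM.
Qed.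

Fact residue_mulC : commutative residue_mul.
Proof. by move=> u v; rewrite /residue_mul mulrC. Qed.

Fact residue_mul1 : left_id (resid 1) residue_mul.
Proof.
move=> u; have [a Oa ->] := residP u; rewrite resid_mul ?mul1r //; exact: valring1.
Qed.

Fact residue_mulDl : left_distributive residue_mul residue_add.
Proof.
move=> u v w; have [[a Oa ->] [b Ob ->] [c Oc ->]] := And3 (residP u) (residP v) (residP w).
rewrite resid_add // !resid_mul //; last exact: valringD.
by rewrite resid_add ?mulrDl //; apply: valringM.
Qed.

Fact residue_one_neq0 : resid 1 != 0.
Proof.
apply/eqP => /eq_resid; rewrite subr0 => h.
apply: (vunit_vmax (vunit1 vO)); apply: h; [exact: valring1 | exact: valring0].
Qed.

HB.instance Definition _ := GRing.Zmodule_isComNzRing.Build R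
  residue_mulA residue_mulC residue_mul1 residue_mulDl residue_one_neq0.

Fact residue_mulV (u : R) : u != 0 -> residue_inv u * u = 1.
Proof.
move=> u0; have Ou := residue_valring u.
have uu : vunit O (val u).
  apply: not_vmax => // mu; case/eqP: u0; rewrite -[u]residue_valK.
  by apply/eq_resid => //; [apply: valring0 | rewrite subr0].
have [nz _ Oui] := uu.
rewrite -{2}[u]residue_valK -[LHS]/(residue_mul _ _) resid_mul //.
by rewrite mulVf.
Qed.

(** The representative of the class 0 may be a nonzero element of the maximal ideal. Its inverse
    then lies outside [O], where [resid] takes the value 0. *)
Fact residue_inv0 : residue_inv 0 = 0.
Proof.
have O0 := valring0 vO; have m0 := val_resid O0; rewrite sub0r in m0.
have {}m0 : vmax (val (resid 0)) by rewrite -[val _]opprK; apply: vmaxN.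
rewrite /residue_inv -[0 in LHS]/(resid 0).
have [->|n0] := eqVneq (val (resid 0)) 0; first by rewrite invr0.
have nO : ~ O (val (resid 0))^-1.
  by case: m0 => _ [/eqP|//]; rewrite (negbTE n0).
by apply: val_inj; rewrite /= {1}/vclass; case: asboolP => // _; rewrite /vclass; case: asboolP.
Qed.

HB.instance Definition _ := GRing.ComNzRing_isField.Build R residue_mulV residue_inv0.

(** The residue map is a total function specified only on [O]; from here on the choice of
    representatives is hidden. *)
Lemma exists_residue_field : exists (R : fieldType) (res : F -> R),
  [/\ res 1 = 1, forall a b, O a -> O b -> res (a + b) = res a + res b,
      forall a b, O a -> O b -> res (a * b) = res a * res b,
      forall u, exists2 a, O a & res a = u &
      forall a, O a -> (res a = 0 <-> vmax a)].
Proof.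
exists (residue_sort : fieldType), resid; split => //.
- by move=> a b Oa Ob; rewrite -resid_add.
- by move=> a b Oa Ob; rewrite -resid_mul.
- by move=> u; have [a Oa ->] := residP u; exists a.
- by move=> a Oa; have := eq_resid Oa (valring0 vO); rewrite subr0.
Qed.

End ResidueField.

Lemma mcoeff_sum_X (R : nzRingType) n (s : seq 'X_{1.. n}) (c : 'X_{1.. n} -> R) k :
  uniq s -> (\sum_(m <- s) c m *: 'X_[m])@_k = if k \in s then c k else 0.
Proof.
move=> us; rewrite raddf_sum /=; case: ifP => ks.
  rewrite (bigD1_seq k) //= mcoeffZ mcoeffX eqxx mulr1 big1 ?addr0 // => m /negbTE nm.
  by rewrite mcoeffZ mcoeffX nm mulr0.
rewrite big_seq big1 // => m ms; rewrite mcoeffZ mcoeffX; case: eqP => [e|_].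
  by rewrite -e ms in ks.
by rewrite mulr0.
Qed.

Lemma fin_generated_seq (F : fieldType) (K : F -> Prop) (S : seq F) :
  (forall z, adj K S z) -> fin_generated K.
Proof.
move=> hS; exists (size S), (fun i => nth 0 S i) => z.
by rewrite adjoin_frange codom_nth.
Qed.

(** * Translation of the residue conditions into statements about the residue field *)

Section ResidueTransfer.
Variables (F : fieldType) (O : F -> Prop) (vO : is_valring O).
Variables (R : fieldType) (res : F -> R).
Hypotheses (res1 : res 1 = 1)
  (resD : forall a b, O a -> O b -> res (a + b) = res a + res b)
  (resM : forall a b, O a -> O b -> res (a * b) = res a * res b)
  (res_surj : forall u, exists2 a, O a & res a = u)
  (res_eq0 : forall a, O a -> (res a = 0 <-> vmax O a)).
Implicit Types (E : F -> Prop).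

Lemma res0 : res 0 = 0.
Proof. by apply/res_eq0; [apply: valring0 | apply: vmax0]. Qed.

Lemma resB a b : O a -> O b -> res (a - b) = res a - res b.
Proof.
move=> Oa Ob; have := resD (valringB vO Oa Ob) Ob; rewrite subrK => ->.
by rewrite addrK.
Qed.

Lemma res_sum I (r : seq I) (P : pred I) (G : I -> F) : (forall i, P i -> O (G i)) ->
  res (\sum_(i <- r | P i) G i) = \sum_(i <- r | P i) res (G i).
Proof.
move=> OG; suff [] : O (\sum_(i <- r | P i) G i) /\
    res (\sum_(i <- r | P i) G i) = \sum_(i <- r | P i) res (G i) by [].
apply: (big_ind2 (fun a u => O a /\ res a = u)) => [|a u b v [Oa <-] [Ob <-]|i Pi].
- by split; [apply: valring0 | apply: res0].
- by split; [apply: valringD | apply: resD].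
- by split; first exact: OG.
Qed.

Lemma res_prod I (r : seq I) (P : pred I) (G : I -> F) : (forall i, P i -> O (G i)) ->
  res (\prod_(i <- r | P i) G i) = \prod_(i <- r | P i) res (G i).
Proof.
move=> OG; suff [] : O (\prod_(i <- r | P i) G i) /\
    res (\prod_(i <- r | P i) G i) = \prod_(i <- r | P i) res (G i) by [].
apply: (big_ind2 (fun a u => O a /\ res a = u)) => [|a u b v [Oa <-] [Ob <-]|i Pi].
- by split; [apply: valring1 | apply: res1].
- by split; [apply: valringM | apply: resM].
- by split; first exact: OG.
Qed.

Lemma resX a n : O a -> res (a ^+ n) = res a ^+ n.
Proof.
move=> Oa; elim: n => [|n IH]; first by rewrite !expr0.
by rewrite !exprS resM ?IH //; apply: valringX.
Qed.

Lemma valring_nat n : O n%:R.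
Proof.
elim: n => [|n IH]; first exact: valring0.
by rewrite -addn1 natrD; apply: valringD => //; apply: valring1.
Qed.

Lemma res_nat n : res n%:R = n%:R.
Proof.
elim: n => [|n IH]; first exact: res0.
by rewrite -addn1 !natrD resD ?IH ?res1 //; [apply: valring_nat | apply: valring1].
Qed.

Lemma resV a : vunit O a -> res a^-1 = (res a)^-1.
Proof.
move=> [a0 Oa Oai]; have := resM Oa Oai; rewrite divff // res1 => h.
have r0 : res a != 0 by apply: contra_eq_neq h => ->; rewrite mul0r oner_eq0.
by apply: (mulfI r0); rewrite -h divff.
Qed.

Lemma res_pchar p : p \in [pchar R] <-> prime p /\ vmax O p%:R.
Proof.
rewrite inE; split=> [/andP [pp /eqP h]|[pp h]].
  by split=> //; apply/res_eq0; [apply: valring_nat | rewrite res_nat].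
by rewrite pp -res_nat; apply/eqP/res_eq0 => //; apply: valring_nat.
Qed.

(** For a subfield [E], its residue field Ev inside Fv. *)
Definition resf E : R -> Prop := fun u => exists2 a, E a /\ O a & res a = u.

Lemma resf_subfield E : is_subfield E -> is_subfield (resf E).
Proof.
move=> sE; split=> [|_ _ [a [Ea Oa] <-] [b [Eb Ob] <-]|_ _ [a [Ea Oa] <-] [b [Eb Ob] <-]
    |_ [a [Ea Oa] <-]].
- by exists 1 => //; split; [apply: subfield1 | apply: valring1].
- by exists (a - b); [split; [apply: subfieldB | apply: valringB] | apply: resB].
- by exists (a * b); [split; [apply: subfieldM | apply: valringM] | apply: resM].
- case: (EM (vmax O a)) => [ma|na].
    rewrite (proj2 (res_eq0 Oa) ma) invr0; exists 0; last exact: res0.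
    by split; [apply: subfield0 | apply: valring0].
  have ua := not_vmax Oa na; exists a^-1; last exact: resV.
  by split; [apply: subfieldV | case: ua].
Qed.

Lemma res_lin_indepE E n (y : 'I_n -> F) : (forall i, O (y i)) ->
  res_lin_indep E O y <-> lin_indep (resf E) (fun i => res (y i)).
Proof.
move=> Oy; split=> hy c Ec h.
  have /choice [d hd] : forall i, exists a, [/\ E a, O a & res a = c i].
    by move=> i; have [a [Ea Oa] e] := Ec i; exists a.
  have Od i : O (d i) by case: (hd i).
  have Ody i : O (d i * y i) by apply: valringM.
  move=> i; have [Ed _ <-] := hd i; apply/res_eq0 => //.
  apply: (hy d) => [j|]; first by have [] := hd j.
  apply/res_eq0; first exact: valring_sum.
  rewrite res_sum // -[RHS]h; apply: eq_bigr => j _.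
  by rewrite resM //; have [_ _ ->] := hd j.
have Oc j : O (c j) by case: (Ec j).
have Ocy j : O (c j * y j) by apply: valringM.
move=> i; apply/res_eq0 => //; apply: (hy (fun i => res (c i))) => [j|].
  by exists (c j).
have := proj2 (res_eq0 (valring_sum vO (index_enum _) (fun j _ => Ocy j))) h.
move=> e; rewrite -[RHS]e res_sum //; by apply: eq_bigr => j _; rewrite resM.
Qed.

Lemma res_separableE E : res_separable E O <-> separable_over (resf E).
Proof.
split=> hE p.
  move=> /res_pchar [pp mp] n u hu.
  have /choice [y hy] : forall i, exists a, O a /\ res a = u i.
    by move=> i; have [a Oa e] := res_surj (u i); exists a.
  have Oy i : O (y i) by case: (hy i).
  have uE : u = fun i => res (y i) by apply/funext => i; case: (hy i).
  rewrite uE in hu *; have := hE p pp mp n y Oy (proj2 (res_lin_indepE _ Oy) hu).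
  move/(proj1 (res_lin_indepE _ (fun i => valringX vO p (Oy i)))).
  by under eq_fun => i do rewrite resX //.
move=> pp mp n y Oy /(res_lin_indepE _ Oy) hy; apply/res_lin_indepE => [i|].
  exact: valringX.
under eq_fun => i do rewrite resX //.
by apply: hE => //; apply/res_pchar.
Qed.

Definition mres n (f : {mpoly F[n]}) : {mpoly R[n]} :=
  \sum_(m <- msupp f) res f@_m *: 'X_[m].

Lemma mcoeff_mres n (f : {mpoly F[n]}) m : (mres f)@_m = res f@_m.
Proof.
rewrite mcoeff_sum_X ?msupp_uniq //; case: ifPn => // /memN_msupp_eq0 ->.
by rewrite res0.
Qed.

Lemma meval_mres n (f : {mpoly F[n]}) (y : 'I_n -> F) : (forall m, O f@_m) ->
  (forall i, O (y i)) -> (mres f).@[fun i => res (y i)] = res f.@[y].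
Proof.
move=> Of Oy; have Op m : O (\prod_i y i ^+ m i).
  by apply: valring_prod => // i _; apply: valringX.
rewrite [f.@[y]]mevalE res_sum => [|m _]; last exact: valringM.
rewrite /mres raddf_sum /=; apply: eq_bigr => m _.
rewrite mevalZ mevalX resM // res_prod => [|i _]; last exact: valringX.
by congr (_ * _); apply: eq_bigr => i _; rewrite resX.
Qed.

Lemma res_alg_indepE E n (y : 'I_n -> F) : is_subfield E -> (forall i, O (y i)) ->
  res_alg_indep E O y <-> alg_indep (resf E) (fun i => res (y i)).
Proof.
move=> sE Oy; split=> hy f Ef; last first.
  move=> [m nm] mf; apply: nm; apply/res_eq0; first by case: (Ef m).
  have Of k : O f@_k by case: (Ef k).
  rewrite -mcoeff_mres (hy (mres f)) ?mcoeff0 // => [k|].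
    by rewrite mcoeff_mres; exists f@_k.
  by rewrite meval_mres //; apply/res_eq0 => //; apply: valring_meval.
move=> h; apply: contrapT => /eqP f0.
have /choice [d hd] : forall m, exists a, [/\ E a, O a & res a = f@_m].
  by move=> m; have [a [Ea Oa] e] := Ef m; exists a.
pose g := \sum_(m <- msupp f) d m *: 'X_[m].
have gE m : g@_m = if m \in msupp f then d m else 0 by rewrite mcoeff_sum_X ?msupp_uniq.
have Eg m : E g@_m /\ O g@_m.
  rewrite gE; case: ifP => _; last by split; [apply: subfield0 | apply: valring0].
  by have [] := hd m.
have mg : mres g = f.
  apply/mpolyP => m; rewrite mcoeff_mres gE; case: ifPn => [_|/memN_msupp_eq0 ->].
    by have [] := hd m.
  exact: res0.
have Og m : O g@_m by case: (Eg m).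
apply: (hy g Eg); last first.
  by apply/res_eq0; [apply: valring_meval | rewrite -meval_mres // mg].
apply/not_existsP => ng; move/eqP: f0; apply; apply/mpolyP => m.
rewrite mcoeff0 -mg mcoeff_mres; apply/res_eq0 => //.
by apply: contrapT; apply: ng.
Qed.

(** Divided by its coefficient of least value, a relation has coefficients in [O], one of them 1, so
    it reduces to a nontrivial relation between the residues. This yields [Fv : Ev] <= [F : E]. *)
Lemma res_free_lift E (I : finType) (a : I -> F) : is_subfield E -> (forall i, O (a i)) ->
  free_fam (resf E) (fun i => res (a i)) -> free_fam E a.
Proof.
move=> sE Oa fa c Ec h; apply: contrapT => /existsNP [i1 /eqP ci1].
pose s := [seq i <- enum I | c i != 0].
have i1s : i1 \in s by rewrite mem_filter ci1 mem_enum.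
have [||i0] := @exists_vmin _ _ vO _ s c.
- by case: (s) i1s.
- by move=> i; rewrite mem_filter => /andP [].
rewrite mem_filter => /andP [c0 _] hi0.
have Oc i : O (c i / c i0).
  have [->|ci] := eqVneq (c i) 0; first by rewrite mul0r; apply: valring0.
  by apply: hi0; rewrite mem_filter ci mem_enum.
have := fa (fun i => res (c i / c i0)) _ _ i0.
rewrite divff // res1 => /(_ _ _) h1; have : 1 = 0 :> R; last by move/eqP; rewrite oner_eq0.
apply: h1 => [i|]; first by exists (c i / c i0) => //; split => //; apply: subfield_div.
have S0 : \sum_i c i / c i0 * a i = 0.
  transitivity ((\sum_i c i * a i) / c i0); last by rewrite h mul0r.
  by rewrite mulr_suml; apply: eq_bigr => i _; rewrite mulrAC.
rewrite -[RHS]res0 -[in RHS]S0 res_sum => [|i _]; last exact: valringM.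
by apply: eq_bigr => i _; rewrite [RHS]resM.
Qed.

(** A residue transcendental over those of [y] would, once lifted, give [s + 1] elements with
    independent residues. *)
Lemma res_trbasis K s (y : 'I_s -> F) : is_subfield K -> (forall i, O (y i)) ->
  res_alg_indep K O y ->
  (forall y : 'I_s.+1 -> F, (forall i, O (y i)) -> ~ res_alg_indep K O y) ->
  trbasis (resf K) (fun i => res (y i)).
Proof.
move=> sK Oy hy hs; have aiy := proj1 (res_alg_indepE sK Oy) hy.
split=> // u; apply: contrapT => nu; have [a Oa au] := res_surj u.
have Oya i : O (ord_ext y a i) by rewrite /ord_ext; case: unlift.
apply: (hs (ord_ext y a) Oya); apply/res_alg_indepE => //.
apply/alg_indepS; first exact: resf_subfield.
have -> : ord_init (fun i => res (ord_ext y a i)) = fun i => res (y i).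
  by apply/funext => i; rewrite /ord_init ord_ext_widen.
by rewrite ord_ext_max au -adjoin_frange.
Qed.

Lemma resf_adj K E s (y : 'I_s -> F) : is_subfield K -> is_subfield E ->
  (forall a, K a -> E a) -> (forall i, E (y i)) -> resfield_gen K E O y ->
  resf E = adjoin (resf K) (frange (fun i => res (y i))).
Proof.
move=> sK sE KE Ey [Oy [hE _]]; have sr := resf_subfield sK.
rewrite predeqE => u; split.
  move=> [a [Ea Oa] <-]; have [f [g [Kf Kg ug mf]]] := hE a Ea Oa.
  have Of m : O f@_m by case: (Kf m).
  have Og m : O g@_m by case: (Kg m).
  have Ofy : O f.@[y] by apply: valring_meval.
  have [_ Ogy Ogyi] := ug.
  have -> : res a = res f.@[y] / res g.@[y].
    rewrite -resV // -resM //; apply/eqP; rewrite -subr_eq0 -resB //; last exact: valringM.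
    by apply/eqP/res_eq0 => //; apply: valringB => //; apply: valringM.
  rewrite adjoin_frange -!meval_mres //; apply: (subfield_div (adj_subfield _ _)).
    by apply: adj_meval => m; rewrite mcoeff_mres; exists f@_m.
  by apply: adj_meval => m; rewrite mcoeff_mres; exists g@_m.
apply; first exact: resf_subfield.
  by move=> v [a [Ka Oa] <-]; exists a => //; split => //; apply: KE.
by move=> v [i <-]; exists (y i).
Qed.

(** Fv is finite over Ev by [res_free_lift], and Ev is generated over Kv by the residues of [y]. *)
Lemma resf_fin_generated K E s (y : 'I_s -> F) (J : finType) (b : J -> F) :
  is_subfield K -> is_subfield E -> (forall a, K a -> E a) -> (forall i, E (y i)) ->
  resfield_gen K E O y -> (forall z, spanned E b z) -> fin_generated (resf K).
Proof.
move=> sK sE KE Ey hE sb; have srE := resf_subfield sE.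
have [I|I [f [_ sf]]] := @exists_basis_bounded _ (resf E) #|J| srE.
  move=> u fu; have /choice [a ha] : forall i, exists a, O a /\ res a = u i.
    by move=> i; have [a Oa e] := res_surj (u i); exists a.
  have fa : free_fam E a.
    apply: res_free_lift => // [i|]; first by case: (ha i).
    by have -> : (fun i => res (a i)) = u; [apply/funext => i; case: (ha i) |].
  exact: (free_fam_leq sE fa (fun i => sb (a i))).
apply: (@fin_generated_seq _ _ (codom (fun i => res (y i)) ++ codom f)) => z.
rewrite adj_cat -adjoin_frange -(resf_adj sK sE KE Ey hE).
have [c Ec ->] := sf z; have s' := adj_subfield (resf E) (codom f).
apply: (subfield_sum s') => i _; apply: (subfieldM s'); first exact: adj_base.
by apply: adj_gen; apply: codom_f.
Qed.

End ResidueTransfer.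

(** * Nontrivial and trivial valuations *)

Section Main.
Variables (F : fieldType) (K O : F -> Prop).
Hypotheses (sK : is_subfield K) (vO : is_valring O).
Hypotheses (fK : fin_generated K) (hK : separable_over K).

Section Nontrivial.
Variable w0 : F.
Hypotheses (w00 : w0 != 0) (mw0 : vmax O w0).
Variables (r s : nat) (t : 'I_(r + s) -> F).
Hypothesis ht : trbasis K t.

(** The basis [t] fixes the transcendence degree as [r + s]. Every family close to [catf x y] keeps
    independent values and residues, hence is algebraically independent and, by its size, a
    transcendence basis. *)
Lemma perturb_valuation_basis (x : 'I_r -> F) (y : 'I_s -> F) :
  (forall i, x i != 0) -> vindep K O x -> (forall i, O (y i)) -> res_alg_indep K O y ->
  exists (x' : 'I_r -> F) (y' : 'I_s -> F),
    let KT := adjoin K (frange (catf x' y')) in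
    [/\ forall i, vclose O (x i) (x' i), forall i, vclose O (y i) (y' i) &
        [/\ trbasis K (catf x' y'), separable_over KT,
            vgroup_sum K KT O x' & resfield_gen K KT O y']].
Proof.
move=> x0 hx Oy hy.
have close (w' : 'I_(r + s) -> F) : (forall i, vclose O (catf x y i) (w' i)) ->
    [/\ forall i, vclose O (x i) (w' (lshift s i)), forall i, vclose O (y i) (w' (rshift r i)) &
        [/\ forall i, w' (lshift s i) != 0, vindep K O (fun i => w' (lshift s i)),
            (forall i, O (w' (rshift r i))) & res_alg_indep K O (fun i => w' (rshift r i))]].
  move=> hw'.
  have cx i : vclose O (x i) (w' (lshift s i)) by rewrite -(catf_lshift x y).
  have cy i : vclose O (y i) (w' (rshift r i)) by rewrite -(catf_rshift x y).
  have Oy' i : O (w' (rshift r i)).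
    have [my _] := cy i; rewrite -[w' _](subrK (y i)); apply: valringD => //.
    by case: my.
  split => //; split => //.
  - by move=> i; apply: vclose_neq0 (x0 i) (cx i).
  - exact: vclose_vindep cx hx.
  - by apply: (cong_res_alg_indep _ Oy) => // i; case: (cy i).
have catE (w' : 'I_(r + s) -> F) :
    catf (fun i => w' (lshift s i)) (fun i => w' (rshift r i)) = w'.
  by apply/funext => i; rewrite /catf -[in RHS](splitK i); case: (split i).
have [|p a z charFp|w' cw'|w' [cw' tw' sw']] :=
  perturb_separating sK hK fK (w := catf x y) (P := vclose O) ht.
- exact: vclose_refl.
- exact: (vclose_perturb vO a z w00 mw0 (prime_gt0 (pcharf_prime charFp))).
- have [_ _ [x'0 hx' Oy' hy']] := close _ cw'.
  by have := vindep_alg_indep sK vO x'0 hx' Oy' hy'; rewrite catE.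
have [cx cy [x'0 hx' Oy' hy']] := close _ cw'.
exists (fun i => w' (lshift s i)), (fun i => w' (rshift r i)); split => //.
split; [by rewrite catE | by rewrite catE | |].
  exact: vindep_vgroup_sum.
exact: res_alg_indep_resfield_gen.
Qed.

Lemma perturb_valuation_basis_full (x0 : 'I_r -> F) (y0 : 'I_s -> F) :
  (forall i, x0 i != 0) -> vindep K O x0 ->
  (forall b : 'I_r.+1 -> F, (forall i, b i != 0) -> ~ vindep K O b) ->
  (forall i, O (y0 i)) -> res_alg_indep K O y0 ->
  (forall y : 'I_s.+1 -> F, (forall i, O (y i)) -> ~ res_alg_indep K O y) ->
  vtorsion_free K O -> res_separable K O ->
  exists (x : 'I_r -> F) (y : 'I_s -> F),
    let KT := adjoin K (frange (catf x y)) in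
    [/\ trbasis K (catf x y), separable_over KT,
        vgroup_sum K KT O x & resfield_gen K KT O y] /\
    vgroup_full KT O /\ res_separable KT O.
Proof.
move=> x00 hx0 hr Oy0 hy0 hs tf rs.
(* An auxiliary field over which [F] is finite: its degree bounds both the index of vE in vF and
   [Fv : Ev]. *)
pose E := adjoin K (frange (catf x0 y0)).
have sE : is_subfield E := adjoin_subfield _ _.
have KE a : K a -> E a by apply: adjoin_base.
have Ey i : E (y0 i) by apply: adjoin_gen; exists (rshift r i); rewrite catf_rshift.
have tE := trbasis_alg_indep sK ht (vindep_alg_indep sK vO x00 hx0 Oy0 hy0).
have [J [b sb]] : exists (J : finType) (b : J -> F), forall z, spanned E b z.
  rewrite /E adjoin_frange; apply: fin_generated_finite => // z.
  by rewrite -adjoin_frange; case: tE.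
have [_ vE] := vindep_vgroup_sum sK vO x00 hx0 Oy0 hy0.
have rE := res_alg_indep_resfield_gen sK vO x00 hx0 Oy0 hy0.
have [x [xn0 hx xfull]] := exists_value_basis sK vO tf x00 hx0 hr sE sb vE.
have [R [res [res1 resD resM res_surj res_eq0]]] := exists_residue_field vO.
have sKv := resf_subfield vO res1 resD resM res_eq0 sK.
have fKv := resf_fin_generated vO res1 resD resM res_surj res_eq0 sK sE KE Ey rE sb.
have hKv := proj1 (res_separableE vO res1 resD resM res_surj res_eq0 K) rs.
have tKv := res_trbasis vO res1 resD resM res_surj res_eq0 sK Oy0 hy0 hs.
have [w [tw sw]] := exists_separating_trbasis sKv hKv fKv tKv.
have /choice [y hy] : forall i, exists a, O a /\ res a = w i.
  by move=> i; have [a Oa e] := res_surj (w i); exists a.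
have Oy i : O (y i) by case: (hy i).
have wE : w = fun i => res (y i) by apply/funext => i; case: (hy i).
have hyi : res_alg_indep K O y.
  by apply/(res_alg_indepE vO res1 resD resM res_eq0 sK Oy); rewrite -wE; case: tw.
(* The perturbation changes neither the values of [x] nor the residues of [y], so what these were
   chosen for survives. *)
have [x' [y' [cx cy hT]]] := perturb_valuation_basis xn0 hx Oy hyi.
exists x', y'; split => //; case: hT => tT sT gT rT.
set KT := adjoin K _ in sT gT rT *.
have sKT : is_subfield KT := adjoin_subfield _ _.
have x'0 i : x' i != 0 := vclose_neq0 vO (xn0 i) (cx i).
split.
  move=> z z0.
  have [m [c [Kc c0 u]]] : vspan K O x' z.
    apply: (vspan_sub sK vO xn0 x'0 _ (xfull z z0)) => i.
    rewrite -[x i](divfK (x'0 i)); apply: vspanM => //; last exact: vspan_memb.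
    apply: vspan_in_vK; apply: in_vK_unit => //; rewrite -invf_div; apply: vunitV.
    exact: vclose_vunit.
  exists (c * zmon x' m); split.
  - apply: (subfieldM sKT); first exact: adjoin_base.
    apply: (subfield_prod sKT) => i _; apply: (subfield_exprz sKT); apply: adjoin_gen.
    by exists (lshift s i); rewrite catf_lshift.
  - by rewrite mulf_neq0 // zmon_neq0.
  - by rewrite [c * _]mulrC invfM mulrA.
apply/(res_separableE vO res1 resD resM res_surj res_eq0).
rewrite (resf_adj vO res1 resD resM res_eq0 sK sKT _ _ rT).
- suff -> : (fun i => res (y' i)) = w by [].
  rewrite wE; apply/funext => i; have [my _] := cy i; have Omy := vmax_valring my.
  rewrite -[y' i](subrK (y i)) resD //.
  by rewrite (proj2 (res_eq0 _ Omy) my) add0r.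
- by move=> a; apply: adjoin_base.
- by move=> i; apply: adjoin_gen; exists (rshift r i); rewrite catf_rshift.
Qed.

End Nontrivial.

(** Here [O] is all of [F] and congruence modulo [vmax O] is equality, so that the residue
    conditions are conditions on [F] itself. *)
Lemma trivial_valuation r s (t : 'I_(r + s) -> F) : (forall a, vmax O a -> a = 0) ->
  trbasis K t -> (exists a : 'I_r -> F, (forall i, a i != 0) /\ vindep K O a) ->
  exists (x : 'I_r -> F) (y : 'I_s -> F),
    let KT := adjoin K (frange (catf x y)) in
    [/\ trbasis K (catf x y), separable_over KT,
        vgroup_sum K KT O x & resfield_gen K KT O y] /\
    vgroup_full KT O /\ res_separable KT O.
Proof.
move=> triv ht [a [a0 ha]].
have Oall z : O z.
  apply: contrapT => nz; have z0 : z != 0 by apply: contra_notN nz => /eqP ->; apply: valring0.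
  by have /triv/eqP := vmax_inv vO z0 nz; rewrite invr_eq0 (negbTE z0).
have uall z : z != 0 -> vunit O z by move=> z0; split.
case: r t ht a a0 ha => [|r] t ht a a0 ha; last first.
  (* All nonzero elements being units, exponents 1 already form a nontrivial relation if there is at
     least one [a i]; so the rank is 0. *)
  have P0 : \prod_i a i ^ 1 != 0 by apply/prodf_neq0 => i _; rewrite expfz_neq0.
  by have := ha (fun=> 1) (in_vK_unit sK (uall _ P0)) ord0.
have [w [tw sw]] := exists_separating_trbasis sK hK fK ht.
pose x (i : 'I_0) : F := 1; pose y (i : 'I_s) := w (rshift 0 i).
have cw : catf x y = w.
  apply/funext => i; rewrite /catf -[in RHS](splitK i).
  by case: (split i) => [[]|].
have x0 i : x i != 0 by case: i.
have hx : vindep K O x by move=> m _ [].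
have Oy i : O (y i) by [].
have yw : y = w by apply/funext => i; congr w; apply: val_inj.
have hy : res_alg_indep K O y.
  move=> f Kf [m nm] /triv fy; case: tw => aw _; apply: nm.
  rewrite (aw f) ?mcoeff0 //; [exact: vmax0 | by move=> k; case: (Kf k) | by rewrite -yw].
exists x, y; rewrite /= cw; split; first split => //.
- by rewrite -cw; apply: vindep_vgroup_sum.
- by rewrite -cw; apply: res_alg_indep_resfield_gen.
split.
  move=> z z0; exists 1; rewrite divr1 oner_eq0; split; [|by []|exact: uall].
  exact: subfield1 (adjoin_subfield _ _).
move=> p pp /triv p0 n u Ou hu c Ec /triv e i.
(* The residue characteristic is the characteristic of [F], since p%:R has become 0. *)
have charFp : p \in [pchar F] by rewrite inE pp p0 eqxx.
have lu : lin_indep (adjoin K (frange w)) u.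
  move=> d Ed h j; apply: triv; apply: hu => [k|]; first by split.
  by rewrite h; apply: vmax0.
rewrite (sw p charFp n u lu c _ e i); first exact: vmax0.
by move=> j; case: (Ec j).
Qed.

End Main.

(** The absence of transcendence defect is expressed by a transcendence basis with [r + s] elements.
    The proof distinguishes whether a nonzero element of positive value exists, since its multiples
    and powers are what makes perturbations small. *)
Theorem theorem1p4 (F : fieldType) (K O : F -> Prop) (r s : nat) :
  is_subfield K -> is_valring O ->
  fin_generated K ->
  separable_over K ->
  ratrank_eq K O r -> res_trdeg_eq K O s ->
  (exists t : 'I_(r + s) -> F, trbasis K t) ->
  (exists (x : 'I_r -> F) (y : 'I_s -> F),
     let KT := adjoin K (frange (catf x y)) in
     [/\ trbasis K (catf x y), separable_over KT,
         vgroup_sum K KT O x & resfield_gen K KT O y]) /\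
  (vtorsion_free K O -> res_separable K O ->
   exists (x : 'I_r -> F) (y : 'I_s -> F),
     let KT := adjoin K (frange (catf x y)) in
     [/\ trbasis K (catf x y), separable_over KT,
         vgroup_sum K KT O x & resfield_gen K KT O y] /\
     vgroup_full KT O /\ res_separable KT O).
Proof.
move=> sK vO fK hK [ex hr] [[y [Oy hy]] hs] [t ht].
case: (EM (exists2 w, w != 0 & vmax O w)) => [[w w0 mw]|triv]; last first.
  have /(trivial_valuation sK vO fK hK) : forall a, vmax O a -> a = 0.
    by move=> a ma; apply: contrapT => /eqP a0; apply: triv; exists a.
  move=> /(_ _ _ _ ht ex) [x [y' [h h']]].
  by split=> [|_ _]; exists x, y'.
case: ex => x [x0 hx]; split=> [|tf rs]; last first.
  exact: (perturb_valuation_basis_full sK vO fK hK w0 mw ht x0 hx hr Oy hy hs tf rs).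
have [x' [y' [_ _ h]]] := perturb_valuation_basis sK vO fK hK w0 mw ht x0 hx Oy hy.
by exists x', y'.
Qed.
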